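(* Let $U\subseteq\mathbb{R}$ be an open interval and let $f:U\to\mathbb{R}$ be real-analytic. If $$f(\mathscr{L}\cap U)\subseteq\mathscr{L},$$ where $\mathscr{L}$ is the set of Liouville numbers, then there exists a rational function $R\in\mathbb{R}(x)$, with no pole in $U$, such that $f(x)=R(x)$ for every $x\in U$.
   Context: A real number $\xi$ is a Liouville number if for every integer $N\ge 1$ there exist infinitely many pairs $(p,q)\in\mathbb{Z}\times\mathbb{Z}_{>0}$ with $q\ge 2$ such that $0<|\xi-p/q|<q^{-N}$. The set of Liouville numbers is denoted $\mathscr{L}$. *)

(* Defs.v *)
From HB Require Import structures.
From mathcomp Require Import all_boot all_order all_algebra.
From mathcomp Require Import all_classical all_reals all_analysis.

Set Implicit Arguments.
Unset Strict Implicit.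
Unset Printing Implicit Defensive.

Import Order.TTheory GRing.Theory Num.Theory.
Import numFieldNormedType.Exports.

Local Open Scope classical_set_scope.
Local Open Scope ring_scope.

Definition liouville (R : realType) : set R :=
  [set xi : R | forall N : nat, (1 <= N)%N ->
     infinite_set [set pq : int * int |
       2 <= pq.2 /\
       0 < `|xi - pq.1%:~R / pq.2%:~R| < (pq.2%:~R : R) ^- N]].
Arguments liouville : clear implicits.

(* Only the values of [f] on [U] matter: [f] encodes a function U -> R. *)
Definition real_analytic_on (R : realType) (U : set R) (f : R -> R) : Prop :=
  forall x0, U x0 ->
    exists (a : nat -> R) (r : R), 0 < r /\
      forall x, U x -> `|x - x0| < r -> pseries a (x - x0) @ \oo --> f x.

(* Main.v *)
(** Suppose that f is not rational; we construct a Liouville number xi with f xi not Liouville,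
    as the limit of points xi_n, each very close to a rational p_n / v_n, such that f xi_n is
    a quadratic irrational (k + sqrt 2) / m and |f xi_n - r/s| >= c s^-20 for s >= S0, uniformly
    in n.

    Passing from xi_n to xi_(n+1) needs a rational x near xi_n at which f x is not too close to
    rationals of moderate height. Put v = b^4 and let x run through finitely many fractions
    (u + i) / v next to xi_n. If all values f x were within 2 s^-14 of rationals r/s with
    b <= s < b^A, many of them would share an exponent e with b^e <= s < b^(e+1). For 2e+2 such
    nodes the determinant with rows (i^j, (r/s) i^j), j <= e, is then comparable to
    v^-((e+1)^2) times the Toeplitz determinant of the Taylor coefficients a_(e+1+i-j) of f at
    xi_n; if the latter is nonzero this contradicts the lower bound 1 / prod s on a nonzero
    determinant of rationals.

    The Toeplitz determinants are analytic functions of the point, so each has isolated zeros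
    or vanishes near a point. In the second case the Pade approximants of f of that degree
    do not depend on the centre, so f is rational near the point and, by the identity theorem,
    on U. *)

Require Import Defs.
From HB Require Import structures.
From mathcomp Require Import all_boot all_order all_algebra perm.
From mathcomp Require Import all_classical all_reals all_analysis.
From mathcomp Require Import ring lra zify.

Set Implicit Arguments.
Unset Strict Implicit.
Unset Printing Implicit Defensive.

Import Order.TTheory GRing.Theory Num.Theory.
Import numFieldNormedType.Exports.

Local Open Scope classical_set_scope.
Local Open Scope ring_scope.

(** The exponents come from splitting the denominators s in the step from xi_n to xi_(n+1). For s
    below a constant of stage n, the new point is so close that the bound c s^-20 loses only a
    little of its constant. Up to b, f xi_n being quadratic gives kap s^-2, which survives because
    the two points are O(b^-4) apart. From b to b^n the node x is chosen well. From b^n on, the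
    quadratic value f xi_(n+1) takes over: its constant 1/(5m) is only linear in 1/m, and m is of
    the order of b^(14n+1), the inverse of the distance allowed between x and xi_(n+1); so 10 m <=
    b^(14n+2) <= s^18, whence 20 = 18 + 2. The node determinant dictates 4 and 14. As s < b^(e+1),
    the product of the 2e+2 denominators is at most b^(2(e+1)^2), which v^((e+1)^2) must beat, so v
    has to outgrow b^2. The errors s^-14 <= b^(-14e) must remain small after multiplication by
    v^(2e+1) = b^(8e+4), the cost of inverting the Vandermonde matrix of the rescaled nodes; this
    holds for e >= 1. *)

(** * Analytic germs as truncation estimates *)

Section TaylorGerms.
Variable R : realType.
Implicit Types (f g : R -> R) (x z h r : R) (c a : nat -> R).

(** Replaces limit arguments: an estimate proved at every truncation order [K] with a geometric
    error yields the exact one. *)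
Lemma le_add_geometric (x y C q : R) :
  0 <= q < 1 -> (forall K, x <= y + C * q ^+ K) -> x <= y.
Proof.
move=> /andP[q0 q1] H; rewrite leNgt; apply/negP => yx.
have Cp : 0 < C.
  by have := H 0%N; rewrite expr0 mulr1 => ?; rewrite -(ltrD2l y) addr0; lra.
have qcv : (fun K => q ^+ K) @ \oo --> 0.
  by apply: cvg_expr; rewrite ger0_norm.
have [K _ /(_ K (leqnn K))] : \forall K \near \oo, `|q ^+ K| < (x - y) / C.
  have /cvgr0Pnorm_lt := qcv; apply.
  by apply: divr_gt0 => //; lra.
rewrite /= ger0_norm ?exprn_ge0// ltr_pdivlMr// => h.
have := H K; rewrite mulrC in h; lra.
Qed.

(** Analyticity as error bounds for all truncation orders at once: [D = 0] bounds [f] by [M],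
    growing [D] gives convergence for [|z| < rho], and no infinite sum has to be handled. *)
Definition taylor f x c (M rho : R) := 0 < rho /\
  forall D z, `|z| <= rho ->
    `|f (x + z) - \sum_(n < D) c n * z ^+ n| <= M * (`|z| / rho) ^+ D.

Definition germ f x := exists c M rho, taylor f x c M rho.

Lemma taylor_ge0 f x c M rho : taylor f x c M rho -> 0 <= M.
Proof.
move=> [r0 /(_ 0%N 0)]; rewrite normr0 big_ord0 expr0 mulr1 => H.
by apply: le_trans (H (ltW r0)).
Qed.

Lemma taylor_center f x c M rho : taylor f x c M rho -> f x = c 0%N.
Proof.
move=> [r0 /(_ 1%N 0)]; rewrite normr0 mul0r !expr1 mulr0 addr0 => H.
move: (H (ltW r0)); rewrite big_ord1 expr0 mulr1 normr_le0 subr_eq0.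
by move/eqP.
Qed.

(** Subtract the truncations of orders [n] and [n + 1] at [z = rho], where the error ratio is 1. *)
Lemma taylor_coef f x c M rho n : taylor f x c M rho ->
  `|c n| <= 2 * M / rho ^+ n.
Proof.
move=> [r0 H]; have rn : 0 < rho ^+ n by rewrite exprn_gt0.
rewrite ler_pdivlMr//.
have rr : `|rho| <= rho by rewrite gtr0_norm.
have := H n rho rr; have := H n.+1 rho rr.
rewrite (gtr0_norm r0) divff ?gt_eqF// !expr1n !mulr1 big_ord_recr/= => H1 H2.
have -> : `|c n| * rho ^+ n = `|c n * rho ^+ n| by rewrite normrM (gtr0_norm rn).
set S := \sum_(i < n) _ in H1 H2.
have -> : c n * rho ^+ n = (f (x + rho) - S) - (f (x + rho) - (S + c n * rho ^+ n)).
  ring.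
by apply: le_trans (ler_normB _ _) _; lra.
Qed.

Lemma norm_div_le z r r' D : 0 < r' -> r' <= r ->
  (`|z| / r) ^+ D <= (`|z| / r') ^+ D.
Proof.
move=> r0 rr; have r1 := lt_le_trans r0 rr.
apply: lerXn2r; first by rewrite nnegrE divr_ge0// ltW.
  by rewrite nnegrE divr_ge0// ltW.
by apply: ler_wpM2l => //; rewrite lef_pV2 ?posrE.
Qed.

Lemma taylor_shrink f x c M rho rho' : 0 < rho' <= rho ->
  taylor f x c M rho -> taylor f x c M rho'.
Proof.
move=> /andP[r0 rr] T; have M0 := taylor_ge0 T.
case: T => rho0 H; split => // D z zr.
apply: le_trans (H D z (le_trans zr rr)) _.
apply: ler_wpM2l => //; exact: norm_div_le.
Qed.

Lemma geometric_sum_le (q : R) D K : 0 <= q <= 2^-1 ->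
  \sum_(D <= n < K) q ^+ n <= 2 * q ^+ D.
Proof.
move=> /andP[q0 q1].
have [KD|DK] := leqP K D; first by rewrite big_geq// mulr_ge0// exprn_ge0.
suff : \sum_(D <= n < K) q ^+ n <= 2 * q ^+ D - 2 * q ^+ K.
  by move/le_trans; apply; rewrite gerBl mulr_ge0// exprn_ge0.
move: DK => /ltnW DK; elim: K DK => [|K IH] DK.
  by move: DK; rewrite leqn0 => /eqP->; rewrite big_geq// !expr0; lra.
move: DK; rewrite leq_eqVlt => /orP[/eqP<-|DK].
  by rewrite big_geq//; lra.
rewrite big_nat_recr//=; apply: le_trans (lerD (IH DK) (lexx _)) _.
rewrite exprS; have := exprn_ge0 K q0; move: (q ^+ K) => t t0; nra.
Qed.

(** Halving the radius makes the tail geometric of ratio at most 1/2, hence at most twice its first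
    term. *)
Lemma taylor_of_series f x c M rho : 0 < rho ->
  (forall n, `|c n| <= M / rho ^+ n) ->
  (forall z, `|z| <= rho / 2 ->
    (fun K => \sum_(n < K) c n * z ^+ n) @ \oo --> f (x + z)) ->
  taylor f x c (2 * M) (rho / 2).
Proof.
move=> r0 cM H; split; first by rewrite divr_gt0.
move=> D z zr.
have M0 : 0 <= M.
  by have := cM 0%N; rewrite expr0 divr1; apply: le_trans.
have q2 : 0 <= `|z| / rho <= 2^-1.
  apply/andP; split; first by rewrite divr_ge0// ltW.
  by rewrite ler_pdivrMr//; apply: le_trans zr _; lra.
have bnd K : (D <= K)%N ->
    `|\sum_(n < K) c n * z ^+ n - \sum_(n < D) c n * z ^+ n|
      <= 2 * M * (`|z| / (rho / 2)) ^+ D.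
  move=> DK; rewrite -!(big_mkord xpredT (fun n => c n * z ^+ n)).
  rewrite (big_cat_nat (leq0n D) DK)//= addrAC subrr add0r.
  apply: le_trans (ler_norm_sum _ _ _) _.
  apply: (@le_trans _ _ (\sum_(D <= n < K) M * (`|z| / rho) ^+ n)).
    apply: ler_sum => n _; rewrite normrM normrX expr_div_n mulrA.
    rewrite mulrAC; apply: ler_wpM2r; first by rewrite exprn_ge0.
    exact: cM.
  rewrite -mulr_sumr -mulrA mulrCA; apply: ler_wpM2l => //.
  apply: le_trans (geometric_sum_le _ _ q2) _.
  apply: ler_wpM2l => //; apply: norm_div_le; rewrite ?divr_gt0//.
  by rewrite ler_pdivrMr//; lra.
set B := 2 * M * _ in bnd *.
have cv : (fun K => `|\sum_(n < K) c n * z ^+ n - \sum_(n < D) c n * z ^+ n|) @ \oo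
   --> `|f (x + z) - \sum_(n < D) c n * z ^+ n|.
  apply: cvg_norm; apply: cvgB; [exact: H|exact: cvg_cst].
have := cvgr_to_le cv; apply.
by exists D => // K /= DK; apply: bnd.
Qed.

End TaylorGerms.

(** * Closure of germs under sums and products *)

Section GermAlgebra.
Variable R : realType.
Implicit Types (f g : R -> R) (x z h r : R) (c a : nat -> R).

Lemma germ_cst x (k : R) : germ (fun=> k) x.
Proof.
exists (fun n => k *+ (n == 0%N)), `|k|, 1; split => // D z z1.
case: D => [|D]; first by rewrite big_ord0 subr0 expr0 mulr1.
rewrite big_ord_recl big1 => [|i _]; last by rewrite /= mul0r.
by rewrite expr0 mulr1 addr0 subrr normr0 mulr_ge0// exprn_ge0// divr_ge0.
Qed.

Lemma germ_id x : germ (fun y => y) x.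
Proof.
exists (fun n => if n is 0 then x else (n == 1%N)%:R), (`|x| + 1), 1.
split => // D z z1; rewrite divr1.
case: D => [|[|D]].
- by rewrite big_ord0 subr0 expr0 mulr1 (le_trans (ler_normD _ _))// lerD2l.
- rewrite big_ord1 expr0 mulr1 expr1 addrC addKr.
  by rewrite ler_peMl// lerDr.
- rewrite !big_ord_recl big1 => [|i _]; last by rewrite /= mul0r.
  rewrite /= expr0 expr1 mulr1 mul1r addr0 subrr normr0.
  by rewrite mulr_ge0 ?exprn_ge0// addr_ge0.
Qed.

Lemma germD f g x : germ f x -> germ g x -> germ (fun y => f y + g y) x.
Proof.
move=> [a [M [r Tf]]] [b [M' [r' Tg]]].
have r0 := Tf.1; have r'0 := Tg.1; set s := Num.min r r'.
have s0 : 0 < s by rewrite lt_min r0.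
have /taylor_shrink/(_ Tf)[_ Hf] : 0 < s <= r by rewrite s0 ge_min lexx.
have /taylor_shrink/(_ Tg)[_ Hg] : 0 < s <= r' by rewrite s0 ge_min lexx orbT.
exists (fun n => a n + b n), (M + M'), s; split => // D z zs.
have := Hf D z zs; have := Hg D z zs.
under [\sum_(n < D) (a n + b n) * _]eq_bigr do rewrite mulrDl.
rewrite big_split/= mulrDl opprD addrACA => Hg' Hf'.
by apply: le_trans (ler_normD _ _) _; apply: lerD.
Qed.

(* [n + 1 <= 2 ^ n] absorbs the number of terms of a convolution into a smaller radius. *)
Lemma germM f g x : germ f x -> germ g x -> germ (fun y => f y * g y) x.
Proof.
move=> [a [M [r0 Tf0]]] [b [M' [r1 Tg0]]].
pose r := Num.min r0 r1.
have rp : 0 < r by rewrite lt_min Tf0.1 Tg0.1.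
have Tf : taylor f x a M r.
  by apply: taylor_shrink Tf0; rewrite rp ge_min lexx.
have Tg : taylor g x b M' r.
  by apply: taylor_shrink Tg0; rewrite rp ge_min lexx orbT.
have M0 := taylor_ge0 Tf; have M'0 := taylor_ge0 Tg.
pose c n := \sum_(i < n.+1) a i * b (n - i)%N.
(* The errors of [f], of [g] and the tail of the Cauchy product contribute 1, 4 and 8 times
   [M * M' * q]; 20 leaves room. *)
exists c, (20 * M * M'), (r / 4); split => [|D z zr]; first by rewrite divr_gt0.
have zr' : `|z| <= r by apply: le_trans zr _; rewrite ler_pdivrMr//; lra.
pose S := \sum_(n < D) a n * z ^+ n; pose T := \sum_(n < D) b n * z ^+ n.
set q := (_ / (r / 4)) ^+ D.
have qz : (`|z| / r) ^+ D <= q by apply: norm_div_le; [rewrite divr_gt0|rewrite ler_pdivrMr//; lra].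
have q0 : 0 <= q by rewrite exprn_ge0// divr_ge0// ltW// divr_gt0.
have fS : `|f (x + z) - S| <= M * q.
  by apply: le_trans (Tf.2 D z zr') _; apply: ler_wpM2l.
have gT : `|g (x + z) - T| <= M' * q.
  by apply: le_trans (Tg.2 D z zr') _; apply: ler_wpM2l.
have gM : `|g (x + z)| <= M'.
  by have := Tg.2 0%N z zr'; rewrite big_ord0 subr0 expr0 mulr1.
have SM : `|S| <= 4 * M.
  apply: le_trans (ler_norm_sum _ _ _) _.
  apply: (@le_trans _ _ (\sum_(0 <= n < D) 2 * M * (`|z| / r) ^+ n)).
    rewrite big_mkord; apply: ler_sum => n _.
    rewrite normrM normrX expr_div_n mulrA mulrAC.
    apply: ler_wpM2r; first by rewrite exprn_ge0.
    exact: taylor_coef Tf.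
  rewrite -mulr_sumr; have q2 : 0 <= `|z| / r <= 2^-1.
    apply/andP; split; first by rewrite divr_ge0// ltW.
    by rewrite ler_pdivrMr//; apply: le_trans zr _; lra.
  have := geometric_sum_le 0 D q2; rewrite expr0 mulr1 => H.
  have -> : 4 * M = (2 * M) * 2 by ring.
  by apply: ler_wpM2l => //; rewrite mulr_ge0.
have STc : `|S * T - \sum_(n < D) c n * z ^+ n| <= 8 * M * M' * q.
  pose A := \poly_(i < D) a i; pose B := \poly_(i < D) b i.
  have SA : S = A.[z] by rewrite horner_poly.
  have TB : T = B.[z] by rewrite horner_poly.
  have szAB : (size (A * B)%R <= D + D)%N.
    apply: leq_trans (size_polyMleq _ _) _.
    by apply: leq_trans (leq_pred _) _; apply: leq_add; apply: size_poly.
  have abc n : `|(A * B)`_n| <= 4 * M * M' / (r / 2) ^+ n.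
    rewrite coefM; apply: le_trans (ler_norm_sum _ _ _) _.
    apply: (@le_trans _ _ (\sum_(i < n.+1) 4 * M * M' / r ^+ n)).
      apply: ler_sum => i _; rewrite normrM.
      have -> : 4 * M * M' / r ^+ n =
          (2 * M / r ^+ i) * (2 * M' / r ^+ (n - i)).
        have ni : (i <= n)%N by rewrite -ltnS.
        rewrite -{1}(subnKC ni) exprD; field.
        by rewrite !expf_neq0// gt_eqF.
      apply: ler_pM => //.
        rewrite coef_poly; case: ifP => _; first exact: taylor_coef Tf.
        by rewrite normr0 divr_ge0 ?mulr_ge0// exprn_ge0// ltW.
      rewrite coef_poly; case: ifP => _; first exact: taylor_coef Tg.
      by rewrite normr0 divr_ge0 ?mulr_ge0// exprn_ge0// ltW.
    rewrite sumr_const card_ord -[leLHS]mulr_natr expr_div_n invf_div.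
    rewrite [leRHS](_ : _ = 4 * M * M' / r ^+ n * 2 ^+ n); last by ring.
    apply: ler_wpM2l.
      by rewrite divr_ge0 ?mulr_ge0// exprn_ge0// ltW.
    by rewrite -natrX ler_nat ltn_expl.
  have -> : S * T = \sum_(n < D + D) (A * B)`_n * z ^+ n.
    by rewrite SA TB -hornerM (horner_coef_wide _ szAB).
  have -> : \sum_(n < D) c n * z ^+ n = \sum_(n < D) (A * B)`_n * z ^+ n.
    apply: eq_bigr => n _; congr (_ * _); rewrite coefM; apply: eq_bigr => i _.
    rewrite !coef_poly.
    by rewrite (leq_trans (ltn_ord i) (ltn_ord n)) (leq_ltn_trans (leq_subr _ _) (ltn_ord n)).
  rewrite -!(big_mkord xpredT (fun n => (A * B)`_n * z ^+ n)).
  rewrite (big_cat_nat (leq0n D) (leq_addr D D))//= addrAC subrr add0r.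
  apply: le_trans (ler_norm_sum _ _ _) _.
  apply: (@le_trans _ _ (\sum_(D <= n < D + D) (4 * M * M') * (`|z| / (r / 2)) ^+ n)).
    apply: ler_sum => n _; rewrite normrM normrX expr_div_n mulrA mulrAC.
    by apply: ler_wpM2r; rewrite ?exprn_ge0// abc.
  rewrite -mulr_sumr.
  have -> : 8 * M * M' * q = (4 * M * M') * (2 * q) by ring.
  apply: ler_wpM2l; first by rewrite !mulr_ge0.
  apply: le_trans (geometric_sum_le _ _ _) _.
    apply/andP; split; first by rewrite divr_ge0// ltW// divr_gt0.
    by rewrite ler_pdivrMr ?divr_gt0//; apply: le_trans zr _; lra.
  by apply: ler_wpM2l => //; apply: norm_div_le; [rewrite divr_gt0|lra].
have -> : f (x + z) * g (x + z) - \sum_(n < D) c n * z ^+ n =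
  (f (x + z) - S) * g (x + z) + S * (g (x + z) - T)
   + (S * T - \sum_(n < D) c n * z ^+ n) by ring.
apply: le_trans (ler_normD _ _) _.
apply: le_trans (lerD (ler_normD _ _) (lexx _)) _.
rewrite !normrM.
have h1 : `|f (x + z) - S| * `|g (x + z)| <= (M * q) * M' by apply: ler_pM.
have h2 : `|S| * `|g (x + z) - T| <= (4 * M) * (M' * q) by apply: ler_pM.
have : 0 <= M * M' * q by rewrite !mulr_ge0.
by move: h1 h2 STc; lra.
Qed.

End GermAlgebra.

(** * Zeros of germs; convergent power series as germs *)

Section GermZeros.
Variable R : realType.
Implicit Types (f g : R -> R) (x z h r : R) (c a : nat -> R).

Lemma germ_ext f g x : f =1 g -> germ f x -> germ g x.
Proof. by move=> /funext->. Qed.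

Lemma germ_sum (I : Type) (s : seq I) (P : pred I) (F : I -> R -> R) x :
  (forall i, germ (F i) x) -> germ (fun y => \sum_(i <- s | P i) F i y) x.
Proof.
move=> H; elim: s => [|i s IH].
  by apply: (@germ_ext (fun=> 0)); [move=> y; rewrite big_nil|exact: germ_cst].
have [Pi|nPi] := boolP (P i).
  apply: (@germ_ext (fun y => F i y + \sum_(i <- s | P i) F i y)).
    by move=> y; rewrite big_cons Pi.
  exact: germD.
by apply: germ_ext IH => y; rewrite big_cons (negbTE nPi).
Qed.

Lemma germ_prod (I : Type) (s : seq I) (P : pred I) (F : I -> R -> R) x :
  (forall i, germ (F i) x) -> germ (fun y => \prod_(i <- s | P i) F i y) x.
Proof.
move=> H; elim: s => [|i s IH].
  by apply: (@germ_ext (fun=> 1)); [move=> y; rewrite big_nil|exact: germ_cst].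
have [Pi|nPi] := boolP (P i).
  apply: (@germ_ext (fun y => F i y * \prod_(i <- s | P i) F i y)).
    by move=> y; rewrite big_cons Pi.
  exact: germM.
by apply: germ_ext IH => y; rewrite big_cons (negbTE nPi).
Qed.

Lemma germ_det n (F : 'I_n -> 'I_n -> R -> R) x :
  (forall i j, germ (F i j) x) -> germ (fun y => \det (\matrix_(i, j) F i j y)) x.
Proof.
move=> H; rewrite /determinant.
apply: (@germ_ext (fun y => \sum_(s : 'S_n) (-1) ^+ s * \prod_i F i (s i) y)).
  move=> y; apply: eq_bigr => s _; congr (_ * _).
  by apply: eq_bigr => i _; rewrite mxE.
apply: germ_sum => s; apply: germM; first exact: germ_cst.
exact: germ_prod.
Qed.

Lemma germ_horner (p : {poly R}) x : germ (horner p) x.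
Proof.
apply: (@germ_ext (fun y => \sum_(i < size p) p`_i * y ^+ i)).
  by move=> y; rewrite horner_coef.
apply: germ_sum => i; apply: germM; first exact: germ_cst.
elim: (i : nat) => [|n IH]; first exact: germ_cst.
apply: (@germ_ext (fun y => y * y ^+ n)); first by move=> y; rewrite exprS.
by apply: germM => //; exact: germ_id.
Qed.

(** Take [mu] minimal with [c mu != 0]: near the centre the remainder of order [mu + 1] is at most
    half the term of degree [mu]. The explicit lower bound later gives uniform bounds on intervals
    beside the centre. *)
Lemma germ_zero f x : germ f x ->
  (exists2 r, 0 < r & forall z, `|z| < r -> f (x + z) = 0) \/
  (exists r mu w, [/\ 0 < r, 0 < w &
     forall z, `|z| < r -> w * `|z| ^+ mu <= `|f (x + z)|]).
Proof.
move=> [c [M [rho T]]]; have M0 := taylor_ge0 T; have [r0 H] := T.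
have [c0|] := pselect (forall n, c n == 0).
  left; exists rho => // z zr; apply/eqP; rewrite -normr_le0.
  apply: (@le_add_geometric _ _ _ M (`|z| / rho)).
    apply/andP; split; first by rewrite divr_ge0// ltW.
    by rewrite ltr_pdivrMr// mul1r.
  move=> K; rewrite add0r; have := H K z (ltW zr).
  by rewrite big1 ?subr0// => i _; rewrite (eqP (c0 i)) mul0r.
move=> /existsNP[n0 /negP cn0].
have ex : exists n, c n != 0 by exists n0.
case: (ex_minnP ex) => mu cmu mumin.
have cp : 0 < `|c mu| by rewrite normr_gt0.
right; pose e := `|c mu| * rho ^+ mu.+1 / (2 * (M + 1)).
have e0 : 0 < e by rewrite divr_gt0 ?mulr_gt0 ?exprn_gt0//; lra.
exists (Num.min rho e), mu, (`|c mu| / 2); split.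
- by rewrite lt_min r0.
- by rewrite divr_gt0.
move=> z; rewrite lt_min => /andP[zr ze].
have := H mu.+1 z (ltW zr).
rewrite big_ord_recr/= big1 => [|i _]; last first.
  apply/eqP; rewrite mulf_eq0; apply/orP; left; apply/negPn/negP => /mumin.
  by rewrite leqNgt ltn_ord.
rewrite add0r => Hz.
have zm : 0 <= `|z| ^+ mu by rewrite exprn_ge0.
have : M * (`|z| / rho) ^+ mu.+1 <= `|c mu| / 2 * `|z| ^+ mu.
  have rm : 0 < rho ^+ mu.+1 by rewrite exprn_gt0.
  rewrite expr_div_n (exprSr `|z|).
  rewrite [leLHS](_ : _ = M * `|z| / rho ^+ mu.+1 * `|z| ^+ mu); last by ring.
  apply: ler_wpM2r => //; rewrite ler_pdivrMr//.
  have : (M + 1) * `|z| <= (M + 1) * e by apply: ler_wpM2l; [lra|exact: ltW].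
  have -> : (M + 1) * e = `|c mu| / 2 * rho ^+ mu.+1 by rewrite /e; field; lra.
  by have := normr_ge0 z; nra.
have := ler_normD (c mu * z ^+ mu - f (x + z)) (f (x + z)).
rewrite subrK distrC normrM normrX.
by move: Hz; lra.
Qed.

Lemma power_series_exists c (N rho : R) : 0 < rho ->
  (forall n, `|c n| <= N / rho ^+ n) -> exists g : R -> R,
  forall z, `|z| <= rho / 2 -> (fun K => \sum_(n < K) c n * z ^+ n) @ \oo --> g z.
Proof.
move=> r0 cN; exists (fun z => limn (series (fun n => c n * z ^+ n))) => z zr.
have -> : (fun K => \sum_(n < K) c n * z ^+ n) = series (fun n => c n * z ^+ n).
  by apply/funext => K; rewrite seriesEord.
suff : cvgn (series (fun n => c n * z ^+ n)) by [].
apply: normed_cvg; apply: (@series_le_cvg _ _ (geometric N (2^-1))).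
- by move=> n /=.
- move=> n /=; rewrite mulr_ge0 ?exprn_ge0//.
  by have := cN 0%N; rewrite expr0 divr1; apply: le_trans.
- move=> n /=; rewrite normrM normrX.
  have -> : N * 2^-1 ^+ n = N / rho ^+ n * (rho / 2) ^+ n.
    by rewrite exprVn expr_div_n; field; rewrite !expf_neq0 ?gt_eqF.
  by apply: ler_pM; rewrite ?exprn_ge0// lerXn2r ?nnegrE ?divr_ge0// ltW.
- by apply: is_cvg_geometric_series; rewrite ger0_norm; lra.
Qed.

Lemma germ_of_pseries f (U : set R) x0 (c : nat -> R) r : open U -> U x0 -> 0 < r ->
  (forall x, U x -> `|x - x0| < r -> pseries c (x - x0) @ \oo --> f x) ->
  germ f x0.
Proof.
move=> oU Ux0 r0 H.
have /nbhs_ballP[e /= e0 eU] : nbhs x0 U by apply: open_nbhs_nbhs.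
pose rho := Num.min r e / 2.
have m0 : 0 < Num.min r e by rewrite lt_min r0.
have rho0 : 0 < rho by rewrite divr_gt0.
have inU z : `|z| <= rho -> U (x0 + z) /\ `|z| < r.
  move=> zr; have zm : `|z| < Num.min r e by apply: le_lt_trans zr _; rewrite /rho; lra.
  move: zm; rewrite lt_min => /andP[zr' ze]; split => //.
  by apply: eU; rewrite /ball /= opprD addrA subrr add0r normrN.
have cvz z : `|z| <= rho -> (fun K => \sum_(n < K) c n * z ^+ n) @ \oo --> f (x0 + z).
  move=> /inU[Uz zr]; have := H _ Uz.
  rewrite (_ : x0 + z - x0 = z); last by ring.
  move=> /(_ zr).
  rewrite /pseries.
  by have -> : [series c i * z ^+ i]_i = (fun K => \sum_(n < K) c n * z ^+ n)
    by apply/funext => K; rewrite seriesEord.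
(* The terms of the series, which converges at [z = rho], are bounded. *)
have [M cM] : exists M, forall n, `|c n| <= M / rho ^+ n.
  have rr : `|rho| <= rho by rewrite gtr0_norm.
  have cvs : cvgn (series (fun n => c n * rho ^+ n)).
    apply/cvg_ex; exists (f (x0 + rho)); have := cvz rho rr.
    by have -> : series (fun n => c n * rho ^+ n) =
      (fun K => \sum_(n < K) c n * rho ^+ n) by apply/funext => K; rewrite seriesEord.
  have /cvgP/cvg_seq_bounded := cvg_series_cvg_0 cvs.
  move=> [M [Mr HM]]; exists (M + 1) => n.
  rewrite ler_pdivlMr ?exprn_gt0//.
  have := HM (M + 1); rewrite ltrDl ltr01 => /(_ isT n I) /=.
  by rewrite normrM (gtr0_norm (exprn_gt0 _ rho0)).
exists c, (2 * M), (rho / 2); apply: taylor_of_series => // z zr; apply: cvz.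
by apply: le_trans zr _; rewrite ler_pdivrMr//; lra.
Qed.

End GermZeros.

(** * Change of centre in a Taylor expansion *)

Section Recentering.
Variable R : realType.
Implicit Types (f g : R -> R) (x z h r : R) (c a : nat -> R).

(** The added terms vanish; the length [N.+1 + D] allows splitting at [D] whether or not [D] exceeds
    [N]. *)
Lemma binomial_widen (u w : R) N D :
  (u + w) ^+ N = \sum_(0 <= n < N.+1 + D) u ^+ (N - n) * w ^+ n *+ 'C(N, n).
Proof.
rewrite exprDn -(big_mkord xpredT (fun n => u ^+ (N - n) * w ^+ n *+ 'C(N, n))).
rewrite (big_cat_nat (leq0n N.+1) (leq_addr D N.+1))//= [X in _ = _ + X]big1_seq ?addr0//.
move=> n /andP[_]; rewrite mem_index_iota => /andP[Nn _].
by rewrite bin_small// mulr0n.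
Qed.

(** For [n >= D] one has [|z| ^+ n <= (|z| / k) ^+ D * k ^+ n], so the tail is dominated termwise by
    the expansion of [(|h| + k) ^+ N]. *)
Lemma binomial_remainder h z (k : R) N D : 0 < k -> `|z| <= k ->
  `|(h + z) ^+ N - \sum_(n < D) h ^+ (N - n) * z ^+ n *+ 'C(N, n)|
    <= (`|z| / k) ^+ D * (`|h| + k) ^+ N.
Proof.
move=> k0 zk; rewrite (binomial_widen h z N D) (binomial_widen `|h| k N D).
rewrite -(big_mkord xpredT (fun n => h ^+ (N - n) * z ^+ n *+ 'C(N, n))).
rewrite (big_cat_nat (leq0n D) (leq_addl N.+1 D))//= addrAC subrr add0r.
rewrite (big_cat_nat (leq0n D) (leq_addl N.+1 D))//= mulrDr.
have q0 : 0 <= `|z| / k by rewrite divr_ge0// ltW.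
apply: (@le_trans _ _ ((`|z| / k) ^+ D *
    \sum_(D <= n < N.+1 + D) `|h| ^+ (N - n) * k ^+ n *+ 'C(N, n))); last first.
  rewrite lerDr mulr_ge0 ?exprn_ge0// sumr_ge0// => n _.
  by rewrite mulrn_wge0// mulr_ge0 ?exprn_ge0// ltW.
apply: le_trans (ler_norm_sum _ _ _) _; rewrite mulr_sumr.
rewrite big_nat [leRHS]big_nat; apply: ler_sum => n /andP[Dn _].
rewrite normrMn normrM !normrX mulrnAr ler_wMn2r// mulrCA.
apply: ler_wpM2l; first by rewrite exprn_ge0.
have -> : `|z| ^+ n = (`|z| / k) ^+ n * k ^+ n.
  by rewrite -exprMn divfK ?gt_eqF.
apply: ler_wpM2r; first by rewrite exprn_ge0// ltW.
by apply: ler_wiXn2l => //; rewrite ler_pdivrMr// mul1r.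
Qed.

Lemma bin_le_expn N n : ('C(N, n) <= 2 ^ N)%N.
Proof.
have [nN|Nn] := leqP n N; last by rewrite bin_small.
rewrite -[2%N]/(1 + 1)%N expnDn (bigD1 (Ordinal (nN : (n < N.+1)%N)))//=.
by rewrite !exp1n !muln1 leq_addr.
Qed.

(** That the new coefficients are germs in [h] makes the Toeplitz determinants analytic in the
    centre; [M'] and [rho / 4] are independent of [h], as [rational_of_toeplitz] requires. *)
Lemma taylor_recenter f x0 a M rho : taylor f x0 a M rho ->
  exists (b : nat -> R -> R) (M' : R), (forall n, germ (b n) 0) /\
  forall h, `|h| <= rho / 8 -> taylor f (x0 + h) (b^~ h) M' (rho / 4).
Proof.
move=> T; have M0 := taylor_ge0 T; have [r0 H] := T.
(* [al n m] is the coefficient of [h ^+ m] in the [n]-th Taylor coefficient at [x0 + h]. Bounding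
   the binomial by [2 ^ (n + m)] costs half the radius. *)
pose al n m := 'C(n + m, n)%:R * a (n + m)%N.
pose N n := 2 * M * (2 / rho) ^+ n.
have N0 n : 0 <= N n by rewrite !mulr_ge0// exprn_ge0// divr_ge0// ltW.
have alN n m : `|al n m| <= N n / (rho / 2) ^+ m.
  rewrite normrM normr_nat.
  have -> : N n / (rho / 2) ^+ m = 2 ^+ (n + m) * (2 * M / rho ^+ (n + m)).
    rewrite /N !expr_div_n !exprD; field.
    by rewrite !expf_neq0 ?gt_eqF.
  apply: ler_pM => //; last exact: taylor_coef T.
  by rewrite -natrX ler_nat bin_le_expn.
have r20 : 0 < rho / 2 by rewrite divr_gt0.
have /choice[b Hb] : forall n, exists g : R -> R, forall z, `|z| <= rho / 2 / 2 ->
    (fun K => \sum_(m < K) al n m * z ^+ m) @ \oo --> g z.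
  by move=> n; apply: power_series_exists (alN n).
have Tb n : taylor (b n) 0 (al n) (2 * N n) (rho / 2 / 2).
  by apply: taylor_of_series => // z zr; rewrite add0r; apply: Hb.
exists b, (4 * M); split; first by move=> n; exists (al n), (2 * N n), (rho / 2 / 2).
move=> h hr; split => [|D z zr]; first by rewrite divr_gt0.
pose C := M + \sum_(n < D) 2 * N n * (rho / 4) ^+ n.
apply: (@le_add_geometric _ _ _ C (2^-1)); first by lra.
(* Cutting the original series at degree [K + D] keeps every sum finite: the errors [E1] and [E6]
   decay with [K], and [E4] is the claimed bound. *)
move=> K; pose K' := (K + D)%N.
have hzr : `|h + z| <= rho / 2.
  by apply: le_trans (ler_normD _ _) _; move: hr zr; lra.
have half0 : (0 : R) <= 2^-1 by lra.
have half1 : (2^-1 : R) <= 1 by lra.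
have E1 : `|f (x0 + h + z) - \sum_(n < K') a n * (h + z) ^+ n| <= M * 2^-1 ^+ K.
  rewrite -addrA; apply: le_trans (H K' _ _) _; first by apply: le_trans hzr _; lra.
  apply: ler_wpM2l => //; apply: (@le_trans _ _ (2^-1 ^+ K')); last first.
    by apply: ler_wiXn2l => //; rewrite leq_addr.
  apply: lerXn2r; rewrite ?nnegrE// ?divr_ge0// ?(ltW r0)//.
  by rewrite ler_pdivrMr//; move: hzr; lra.
have E2 n : (n < D)%N -> `|b n h - \sum_(m < K' - n) al n m * h ^+ m|
    <= 2 * N n * 2^-1 ^+ K.
  move=> nD; have := (Tb n).2 (K' - n)%N h; rewrite add0r => /(_ _)/le_trans; apply.
    by apply: le_trans hr _; lra.
  apply: ler_wpM2l; first by rewrite mulr_ge0.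
  apply: (@le_trans _ _ (2^-1 ^+ (K' - n))); last first.
    by apply: ler_wiXn2l => //; rewrite /K' -addnBA ?leq_addr// ltnW.
  apply: lerXn2r; rewrite ?nnegrE// ?divr_ge0// ?(ltW r0)//.
  by rewrite ler_pdivrMr ?divr_gt0//; move: hr; lra.
have E3 n : (n < D)%N -> \sum_(m < K' - n) al n m * h ^+ m =
    \sum_(m < K') a m * (h ^+ (m - n) *+ 'C(m, n)).
  move=> nD; have nK : K' = (n + (K' - n))%N 
    by rewrite subnKC// /K' (leq_trans (ltnW nD)) ?leq_addl.
  rewrite [in RHS]nK big_split_ord/= [X in _ = X + _]big1 ?add0r; last first.
    by move=> i _; rewrite bin_small// mulr0n mulr0.
  apply: eq_bigr => m _; by rewrite /al addKn mulr_natl mulrnAl mulrnAr.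
pose Fz m := \sum_(n < D) h ^+ (m - n) * z ^+ n *+ 'C(m, n).
have E4 : `|\sum_(m < K') a m * (h + z) ^+ m - \sum_(m < K') a m * Fz m|
    <= 4 * M * (`|z| / (rho / 4)) ^+ D.
  rewrite -sumrB; apply: le_trans (ler_norm_sum _ _ _) _.
  apply: (@le_trans _ _ (\sum_(0 <= m < K') (2 * M * (`|z| / (rho / 4)) ^+ D) * (2^-1) ^+ m)).
    rewrite big_mkord; apply: ler_sum => m _; rewrite -mulrBr normrM.
    have -> : 2 * M * (`|z| / (rho / 4)) ^+ D * 2^-1 ^+ m =
       (2 * M / rho ^+ m) * ((`|z| / (rho / 4)) ^+ D * (rho / 2) ^+ m).
      rewrite exprVn (expr_div_n rho); field.
      by rewrite !expf_neq0// gt_eqF.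
    apply: ler_pM => //; first exact: taylor_coef T.
    apply: le_trans (binomial_remainder _ _ _ _ zr) _; first by rewrite divr_gt0.
    apply: ler_wpM2l; first by rewrite exprn_ge0// divr_ge0// ltW// divr_gt0.
    apply: lerXn2r; rewrite ?nnegrE.
    - by rewrite addr_ge0// divr_ge0// ltW.
    - by rewrite divr_ge0// ltW.
    - by move: hr; lra.
  rewrite -mulr_sumr.
  have half2 : 0 <= (2^-1 : R) <= 2^-1 by rewrite lexx half0.
  have := geometric_sum_le 0 K' half2; rewrite expr0 mulr1 => G.
  have -> : 4 * M * (`|z| / (rho / 4)) ^+ D = 2 * M * (`|z| / (rho / 4)) ^+ D * 2 by ring.
  apply: ler_wpM2l => //.
  by rewrite !mulr_ge0// exprn_ge0// divr_ge0// ltW// divr_gt0.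
have E5 : \sum_(m < K') a m * Fz m =
   \sum_(n < D) (\sum_(m < K' - n) al n m * h ^+ m) * z ^+ n.
  under eq_bigr do rewrite /Fz mulr_sumr.
  rewrite exchange_big/=; apply: eq_bigr => n _; rewrite E3// mulr_suml.
  by apply: eq_bigr => m _; rewrite !mulrnAr mulrnAl mulrA.
have E6 : `|\sum_(n < D) (\sum_(m < K' - n) al n m * h ^+ m) * z ^+ n
   - \sum_(n < D) b n h * z ^+ n| <= (\sum_(n < D) 2 * N n * (rho / 4) ^+ n) * 2^-1 ^+ K.
  rewrite -sumrB mulr_suml; apply: le_trans (ler_norm_sum _ _ _) _.
  apply: ler_sum => n _; rewrite -mulrBl normrM distrC normrX mulrAC.
  apply: ler_pM; [exact: normr_ge0|by rewrite exprn_ge0|exact: E2|].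
  by apply: lerXn2r; rewrite ?nnegrE// divr_ge0// ltW.
rewrite E5 in E4; rewrite /C mulrDl.
set X := f _ in E1 *.
set A := \sum_(n < K') a n * (h + z) ^+ n in E1 E4.
set B := \sum_(n < D) (\sum_(m < K' - n) al n m * h ^+ m) * z ^+ n in E4 E6.
set E := \sum_(n < D) b n h * z ^+ n in E6 *.
have -> : X - E = (X - A) + (A - B) + (B - E) by ring.
apply: le_trans (ler_normD _ _) _.
apply: le_trans (lerD (ler_normD _ _) (lexx _)) _.
by move: E1 E4 E6; lra.
Qed.

End Recentering.

(** * Toeplitz matrices, Pade approximants, and two tools for comparing approximants *)

Section Toeplitz.
Variable R : realType.
Implicit Types (f g : R -> R) (x z h r : R) (c a : nat -> R).

(** Row [i] expresses that the coefficient of degree [d + 1 + i] vanishes in the product of [f] with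
    a polynomial of degree at most [d]. The indices run from 1 to [2d + 1], so the subtraction never
    truncates. *)
Definition toeplitz c d : 'M[R]_(d.+1) := \matrix_(i, j) c (d.+1 + i - j)%N.

(** The coefficient of [z ^+ n] in [z ^+ j] times the series with coefficients [c]. *)
Definition shifted c (n j : nat) : R := if (j <= n)%N then c (n - j)%N else 0.

Lemma shifted_sum c D j z : (j <= D)%N ->
  z ^+ j * (\sum_(m < D - j) c m * z ^+ m) = \sum_(n < D) shifted c n j * z ^+ n.
Proof.
move=> jD; have [k ->] : exists k, D = (j + k)%N.
  by exists (D - j)%N; rewrite subnKC.
rewrite addKn big_split_ord/= [X in _ = X + _]big1 ?add0r.
  rewrite mulr_sumr; apply: eq_bigr => m _.
  by rewrite /shifted leq_addr addKn exprD mulrCA.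
by move=> i _; rewrite /shifted leqNgt ltn_ord/= mul0r.
Qed.

Lemma taylor_shifted f x c M rho D j z : taylor f x c M rho -> (j <= D)%N ->
  `|z| <= rho ->
  `|z ^+ j * f (x + z) - \sum_(n < D) shifted c n j * z ^+ n|
     <= M * rho ^+ j * (`|z| / rho) ^+ D.
Proof.
move=> [r0 H] jD zr; rewrite -shifted_sum// -mulrBr normrM normrX.
have -> : M * rho ^+ j * (`|z| / rho) ^+ D =
    `|z| ^+ j * (M * (`|z| / rho) ^+ (D - j)).
  have -> : `|z| ^+ j = rho ^+ j * (`|z| / rho) ^+ j.
    by rewrite -exprMn mulrC divfK ?gt_eqF.
  rewrite -[in LHS](subnKC jD) exprD; ring.
by apply: ler_wpM2l; [rewrite exprn_ge0|exact: H].
Qed.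

Lemma det_bound n (A : 'M[R]_n) (B : R) : (forall i j, `|A i j| <= B) ->
  `|\det A| <= #|{: 'S_n}|%:R * B ^+ n.
Proof.
move=> H; apply: le_trans (ler_norm_sum _ _ _) _.
rewrite mulr_natl -sumr_const; apply: ler_sum => s _.
rewrite normrM normrX normrN normr1 expr1n mul1r normr_prod.
rewrite -[X in B ^+ X]card_ord -prodr_const; apply: ler_prod => i _.
by rewrite normr_ge0 H.
Qed.

Lemma cofactor_bound n (A : 'M[R]_n) (B : R) i j : (forall i j, `|A i j| <= B) ->
  `|cofactor A i j| <= #|{: 'S_n.-1}|%:R * B ^+ n.-1.
Proof.
move=> H; rewrite normrM normrX normrN normr1 expr1n mul1r.
by apply: det_bound => k l; rewrite !mxE.
Qed.

(** Deleting the last row and first column leaves the Toeplitz matrix one size smaller; this drives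
    the induction in [toeplitz_nonzero]. *)
Lemma toeplitz_cofactor c d :
  cofactor (toeplitz c d.+1) ord_max ord0 = (-1) ^+ d.+1 * \det (toeplitz c d).
Proof.
rewrite /cofactor /= addn0; congr (_ * \det _).
apply/matrixP => i j; rewrite !mxE /=; congr c.
by rewrite /bump leqNgt ltn_ord/=; lia.
Qed.

Section Pade.
Variables (f : R -> R) (x : R) (c : nat -> R) (M rho : R) (d : nat).
Variable q : 'I_d.+1 -> R.
Hypothesis T : taylor f x c M rho.
Hypothesis qker : forall i : 'I_d.+1, \sum_(j < d.+1) c (d.+1 + i - j)%N * q j = 0.

Definition pade_den : {poly R} := \poly_(j < d.+1) q (inord j).
Definition pade_num : {poly R} :=
  \poly_(n < d.+1) (\sum_(j < d.+1) q j * shifted c n j).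

Lemma pade_denE z : pade_den.[z] = \sum_(j < d.+1) q j * z ^+ j.
Proof.
by rewrite horner_poly; apply: eq_bigr => j _; rewrite inord_val.
Qed.

(** [pade_num] is the part of degree at most [d] of denominator times [f], and [qker] kills the
    degrees [d + 1] to [2d + 1]. The order [2d + 2] is one more than a generic diagonal Pade
    approximant reaches; this is what a singular Toeplitz matrix buys. *)
Lemma pade_remainder z : `|z| <= rho ->
  `|pade_num.[z] - pade_den.[z] * f (x + z)| <=
   (\sum_(j < d.+1) `|q j| * (M * rho ^+ j)) * (`|z| / rho) ^+ (d.+1 + d.+1).
Proof.
move=> zr; rewrite pade_denE horner_poly.
have -> : \sum_(n < d.+1) (\sum_(j < d.+1) q j * shifted c n j) * z ^+ n =
    \sum_(j < d.+1) q j * \sum_(n < d.+1 + d.+1) shifted c n j * z ^+ n.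
  under [RHS]eq_bigr do rewrite mulr_sumr.
  rewrite exchange_big/= big_split_ord/= [X in _ = _ + X]big1 ?addr0.
    apply: eq_bigr => n _; rewrite mulr_suml.
    by apply: eq_bigr => j _; rewrite mulrA.
  move=> i _; under eq_bigr do rewrite mulrA.
  rewrite -mulr_suml (eq_bigr (fun j : 'I_d.+1 => c (d.+1 + i - j)%N * q j)).
    by rewrite qker mul0r.
  move=> j _; rewrite /shifted (leq_trans (ltnW (ltn_ord j))) ?leq_addr//.
  by rewrite mulrC.
rewrite mulr_suml -sumrB mulr_suml; apply: le_trans (ler_norm_sum _ _ _) _.
apply: ler_sum => j _; rewrite -[q j * z ^+ j * _]mulrA -mulrBr normrM -[leRHS]mulrA distrC.
apply: ler_wpM2l => //; apply: taylor_shifted => //.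
by rewrite (leq_trans (ltnW (ltn_ord j))) ?leq_addr.
Qed.

End Pade.

(** The inverse Vandermonde matrix at 0, ..., n - 1 recovers the coefficients from the values. *)
Lemma poly_coef_bound n : exists2 K : R, 0 <= K &
  forall (p : {poly R}) e, (size p <= n)%N ->
    (forall i : 'I_n, `|p.[i%:R]| <= e) -> forall j, `|p`_j| <= K * e.
Proof.
pose V := Vandermonde n (\row_(i < n) (i%:R : R)).
have Vu : V \in unitmx.
  rewrite unitmxE det_Vandermonde unitfE; apply/prodf_neq0 => i _.
  apply/prodf_neq0 => j ij; rewrite !mxE subr_eq0 eqr_nat.
  by rewrite gtn_eqF.
exists (\sum_i \sum_j `|invmx V i j|).
  by apply: sumr_ge0 => i _; apply: sumr_ge0.
move=> p e szp pe j.
have [jn|nj] := ltnP j n; last first.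
  rewrite nth_default ?normr0 ?(leq_trans szp)//.
  have [n0|n0] := posnP n.
    subst n; by rewrite big_ord0 mul0r.
  rewrite mulr_ge0 ?(le_trans _ (pe (Ordinal n0)))//.
  by apply: sumr_ge0 => i _; apply: sumr_ge0.
have E : poly_rV p *m V = \row_i p.[(i : 'I_n)%:R].
  apply/rowP => i; rewrite !mxE (horner_coef_wide _ szp).
  by apply: eq_bigr => k _; rewrite !mxE.
have : poly_rV p = (\row_i p.[(i : 'I_n)%:R]) *m invmx V.
  by rewrite -E mulmxK.
move=> /rowP/(_ (Ordinal jn)); rewrite !mxE /= => ->.
apply: le_trans (ler_norm_sum _ _ _) _; rewrite mulr_suml.
apply: ler_sum => i _; rewrite normrM mxE mulrC.
have e0 : 0 <= e by apply: le_trans (pe i).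
apply: ler_pM => //.
by rewrite (bigD1 (Ordinal jn))//= lerDl sumr_ge0.
Qed.

(** Over [n + 1] equal subintervals the increments add up to at most [K * (y - x) ^+ 2 / (n + 1)];
    let [n] grow. *)
Lemma holder2_const g lo hi (K : R) :
  (forall x y, lo <= x <= hi -> lo <= y <= hi -> x < y ->
     `|g y - g x| <= K * (y - x) ^+ 2) ->
  forall x y, lo <= x <= hi -> lo <= y <= hi -> x < y -> g x = g y.
Proof.
move=> H x y xI yI xy.
have K0 : 0 <= K * (y - x) ^+ 2 by apply: le_trans (H x y xI yI xy).
suff step n : `|g y - g x| * n.+1%:R <= K * (y - x) ^+ 2.
  apply/eqP; rewrite eq_sym -subr_eq0 -normr_le0 leNgt; apply/negP => gp.
  have [n Hn] : exists n, K * (y - x) ^+ 2 < `|g y - g x| * n.+1%:R.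
    pose n := Num.bound (K * (y - x) ^+ 2 / `|g y - g x|).
    exists n; rewrite [ltRHS]mulrC -ltr_pdivrMr//.
    apply: (@lt_le_trans _ _ n%:R); last by rewrite ler_nat.
    by apply: archi_boundP; rewrite divr_ge0.
  by have := step n; rewrite leNgt Hn.
pose t (m : nat) := x + (y - x) * (m%:R / n.+1%:R).
have n0 : 0 < n.+1%:R :> R by rewrite ltr0n.
have tn m : (m <= n.+1)%N -> lo <= t m <= hi.
  move=> mn; have m1 : m%:R / n.+1%:R <= 1 :> R by rewrite ler_pdivrMr// mul1r ler_nat.
  have m0 : 0 <= m%:R / n.+1%:R :> R by rewrite divr_ge0.
  rewrite /t; move: m0 m1 xI yI xy; move: (m%:R / _) => u u0 u1 /andP[? ?] /andP[? ?] xy.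
  by apply/andP; split; nra.
have ind m : (m <= n.+1)%N ->
    `|g (t m) - g x| <= m%:R * (K * ((y - x) / n.+1%:R) ^+ 2).
  elim: m => [|m IH] mn.
    by rewrite /t mul0r mulr0 addr0 subrr normr0 mul0r.
  have tt : t m.+1 - t m = (y - x) / n.+1%:R.
    by rewrite /t -natr1; field; rewrite gt_eqF.
  have lt : t m < t m.+1 by rewrite -subr_gt0 tt divr_gt0// subr_gt0.
  have := H _ _ (tn m (ltnW mn)) (tn m.+1 mn) lt; rewrite tt => H1.
  have -> : g (t m.+1) - g x = (g (t m.+1) - g (t m)) + (g (t m) - g x) by ring.
  apply: le_trans (ler_normD _ _) _; rewrite -natr1 mulrDl mul1r addrC.
  by apply: lerD => //; apply: IH; exact: ltnW.
have := ind n.+1 (leqnn _); rewrite /t divff ?gt_eqF// mulr1 subrKC => H1.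
rewrite -ler_pdivlMr//; apply: le_trans H1 _.
by rewrite le_eqVlt; apply/orP; left; apply/eqP; field; rewrite gt_eqF.
Qed.

End Toeplitz.

(** * Vanishing Toeplitz determinants force rationality *)

Section RationalityCriterion.
Variable R : realType.

(* The Pade approximants centred at x and y both agree with f to order 2d+2, hence differ
   by O((y-x)^2) at any fixed point, so that they do not depend on the centre. *)
Lemma rational_of_toeplitz (f : R -> R) (lo hi M k w : R) (c : R -> nat -> R) d :
  lo < hi -> 0 < k -> 0 < w ->
  (forall x, lo <= x <= hi -> taylor f x (c x) M k) ->
  (forall x, lo <= x <= hi -> \det (toeplitz (c x) d) = 0) ->
  (forall x, lo <= x <= hi ->
     w <= `|cofactor (toeplitz (c x) d) ord_max ord0|) ->
  exists (p q : {poly R}) (hi' : R), lo < hi' /\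
   forall x, lo <= x <= hi' -> q.[x] != 0 /\ f x = p.[x] / q.[x].
Proof.
move=> lohi k0 w0 T det0 wq.
have M0 : 0 <= M.
  by apply: (taylor_ge0 (T lo _)); rewrite lexx ltW.
(* The last-row cofactors are annihilated by every row, the last included since the determinant is
   0. This explicit kernel vector has entries bounded by [B] and first entry at least [w] in size,
   uniformly in [x]. *)
pose q x (j : 'I_d.+1) := cofactor (toeplitz (c x) d) ord_max j.
pose B0 := \sum_(n < d.+1 + d.+1) 2 * M / k ^+ n.
pose B := #|{: 'S_d}|%:R * B0 ^+ d + 1.
have B00 : 0 <= B0 by apply: sumr_ge0 => n _; rewrite divr_ge0 ?mulr_ge0// exprn_ge0// ltW.
have B1 : 1 <= B by rewrite lerDr mulr_ge0// exprn_ge0.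
have Bge0 : 0 <= B by apply: le_trans B1.
have qB x j : lo <= x <= hi -> `|q x j| <= B.
  move=> xI; apply: (@le_trans _ _ (#|{: 'S_d}|%:R * B0 ^+ d)); last by rewrite lerDl.
  apply: cofactor_bound => i l; rewrite mxE.
  apply: le_trans (taylor_coef _ (T x xI)) _.
  have nD : (d.+1 + i - l < d.+1 + d.+1)%N.
    by rewrite (leq_ltn_trans (leq_subr _ _))// ltn_add2l.
  rewrite /B0 (bigD1 (Ordinal nD))//= lerDl sumr_ge0// => n _.
  by rewrite divr_ge0 ?mulr_ge0// exprn_ge0// ltW.
have qker x : lo <= x <= hi ->
    forall i : 'I_d.+1, \sum_(j < d.+1) c x (d.+1 + i - j)%N * q x j = 0.
  move=> xI i; have := mul_mx_adj (toeplitz (c x) d).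
  move=> /matrixP/(_ i ord_max); rewrite !mxE det0// mul0rn => E.
  rewrite -[RHS]E.
  by apply: eq_bigr => j _; rewrite !mxE.
pose Q x := pade_den (q x); pose P x := pade_num (c x) (q x).
pose C := (\sum_(j < d.+1) B * (M * k ^+ j)) / k ^+ (d.+1 + d.+1).
have C0 : 0 <= C.
  rewrite divr_ge0 ?exprn_ge0 ?(ltW k0)// sumr_ge0// => j _.
  by rewrite !mulr_ge0 ?exprn_ge0 ?(ltW k0)//; lra.
have rem x z : lo <= x <= hi -> `|z| <= k ->
    `|(P x).[z] - (Q x).[z] * f (x + z)| <= C * `|z| ^+ (d.+1 + d.+1).
  move=> xI zk; apply: le_trans (pade_remainder (T x xI) (qker x xI) zk) _.
  rewrite expr_div_n /C -[leRHS]mulrA [_^-1 * _]mulrC.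
  apply: ler_wpM2r; first by rewrite divr_ge0 ?exprn_ge0 ?(ltW k0).
  apply: ler_sum => j _; apply: ler_wpM2r; last exact: qB.
  by rewrite mulr_ge0 ?exprn_ge0 ?(ltW k0).
(* For [|z| <= dl] the nonconstant part of [Q x] is at most [w / 2], so the denominators stay away
   from 0. *)
pose dl := Num.min (Num.min 1 k) (w / (2 * d.+1%:R * B)).
have d10 : 0 < d.+1%:R :> R by rewrite ltr0n.
have dl0 : 0 < dl.
  by rewrite !lt_min ltr01 k0 divr_gt0// !mulr_gt0//; lra.
have [dl1 dlk dlw] : [/\ dl <= 1, dl <= k & dl <= w / (2 * d.+1%:R * B)].
  by split; rewrite !ge_min lexx ?orbT.
have Qup x z : lo <= x <= hi -> `|z| <= 1 -> `|(Q x).[z]| <= d.+1%:R * B.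
  move=> xI z1; rewrite /Q pade_denE; apply: le_trans (ler_norm_sum _ _ _) _.
  rewrite mulr_natl -[X in _ *+ X]card_ord -sumr_const; apply: ler_sum => j _.
  rewrite normrM normrX -[leRHS]mulr1; apply: ler_pM => //; rewrite ?exprn_ge0//.
    exact: qB.
  exact: exprn_ile1.
have Qlow x z : lo <= x <= hi -> `|z| <= dl -> w / 2 <= `|(Q x).[z]|.
  move=> xI zd; have z1 := le_trans zd dl1.
  have q0w : w <= `|q x ord0| by exact: wq.
  have : `|(Q x).[z] - q x ord0| <= d.+1%:R * B * `|z|.
    rewrite /Q pade_denE big_ord_recl expr0 mulr1 addrAC subrr add0r.
    apply: le_trans (ler_norm_sum _ _ _) _.
    apply: (@le_trans _ _ (\sum_(i < d) B * `|z|)).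
      apply: ler_sum => j _; rewrite normrM normrX; apply: ler_pM => //.
      - exact: qB.
      - by rewrite lift0 exprS ler_piMr// exprn_ile1.
    rewrite sumr_const card_ord -[leLHS]mulr_natl mulrA; apply: ler_wpM2r => //.
    by apply: ler_wpM2r; [lra|rewrite ler_nat].
  have : d.+1%:R * B * `|z| <= w / 2.
    have : `|z| <= w / (2 * d.+1%:R * B) by apply: le_trans dlw.
    rewrite ler_pdivlMr ?mulr_gt0//; last by lra.
    lra.
  have := ler_normD (q x ord0 - (Q x).[z]) (Q x).[z].
  rewrite subrK distrC; lra.
pose hi' := Num.min hi (lo + dl).
have lohi' : lo < hi' by rewrite lt_min lohi ltrDl.
have hi'hi x : lo <= x <= hi' -> lo <= x <= hi.
  by move=> /andP[-> /=]; rewrite le_min => /andP[].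
have dist x y : lo <= x <= hi' -> lo <= y <= hi' -> `|y - x| <= dl.
  have hidl : hi' <= lo + dl by rewrite ge_min lexx orbT.
  move=> /andP[x1 x2] /andP[y1 y2].
  by rewrite ler_distl; apply/andP; split; lra.
pose n := (d + d).+1.
have [K0 K00 HK0] := poly_coef_bound R n.
pose C1 := 2 * C * (d.+1%:R * B).
have C10 : 0 <= C1.
  apply: mulr_ge0; first exact: mulr_ge0.
  by apply: mulr_ge0 => //; exact: ltW.
pose K := n%:R * (K0 * C1) * n%:R ^+ (d + d) / (w / 2) ^+ 2.
pose Rf x X := (P x).[X - x] / (Q x).[X - x].
have hol X : lo <= X <= hi' -> forall x y, lo <= x <= hi' -> lo <= y <= hi' ->
    x < y -> `|Rf y X - Rf x X| <= K * (y - x) ^+ 2.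
  move=> XI x y xI yI xy; pose h := y - x.
  have h0 : 0 < h by rewrite subr_gt0.
  have hd : h <= dl by rewrite -(gtr0_norm h0) dist.
  have n0 : 0 < n%:R :> R by rewrite ltr0n.
  (* The cross difference of the two approximants, in the coordinate centred at [x]. On [[0, h]]
     both approximate the same values of [f], so it is [O(h ^+ (2d + 2))] there. *)
  pose Pi := P x * (Q y \Po ('X - h%:P)) - (P y \Po ('X - h%:P)) * Q x.
  have PiE Z : Pi.[Z] = (P x).[Z] * (Q y).[Z - h] - (P y).[Z - h] * (Q x).[Z].
    by rewrite /Pi !(hornerE, horner_comp).
  have szPi : (size Pi <= n)%N.
    have szc (p : {poly R}) : size (p \Po ('X - h%:P)) = size p.
      by rewrite size_comp_poly2// size_XsubC.
    have szm (a b : {poly R}) : (size a <= d.+1 -> size b <= d.+1 -> size (a * b)%R <= n)%N.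
      move=> sa sb; apply: leq_trans (size_polyMleq _ _) _.
      by have := leq_add sa sb; rewrite /n; clear; lia.
    apply: leq_trans (size_polyD _ _) _; rewrite size_polyN geq_max.
    by rewrite !szm ?szc ?size_poly.
  have Pis Z : 0 <= Z <= h -> `|Pi.[Z]| <= C1 * h ^+ (d.+1 + d.+1).
    move=> /andP[Z0 Zh]; rewrite PiE.
    have nZ : `|Z| <= h by rewrite ger0_norm.
    have nZh : `|Z - h| <= h by rewrite ler_distl; apply/andP; split; lra.
    have e1 := rem x Z (hi'hi _ xI) (le_trans nZ (le_trans hd dlk)).
    have e2 := rem y (Z - h) (hi'hi _ yI) (le_trans nZh (le_trans hd dlk)).
    have u1 := Qup y (Z - h) (hi'hi _ yI) (le_trans nZh (le_trans hd dl1)).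
    have u2 := Qup x Z (hi'hi _ xI) (le_trans nZ (le_trans hd dl1)).
    have fe : y + (Z - h) = x + Z by rewrite /h; ring.
    rewrite fe in e2.
    have hp (t : R) : `|t| <= h -> C * `|t| ^+ (d.+1 + d.+1) <= C * h ^+ (d.+1 + d.+1).
      by move=> th; apply: ler_wpM2l => //; apply: lerXn2r; rewrite ?nnegrE// ltW.
    have {}e1 := le_trans e1 (hp _ nZ); have {}e2 := le_trans e2 (hp _ nZh).
    have -> : (P x).[Z] * (Q y).[Z - h] - (P y).[Z - h] * (Q x).[Z] =
      ((P x).[Z] - (Q x).[Z] * f (x + Z)) * (Q y).[Z - h]
      - ((P y).[Z - h] - (Q y).[Z - h] * f (x + Z)) * (Q x).[Z] by ring.
    apply: le_trans (ler_normB _ _) _; rewrite !normrM.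
    have -> : C1 * h ^+ (d.+1 + d.+1) =
      C * h ^+ (d.+1 + d.+1) * (d.+1%:R * B) + C * h ^+ (d.+1 + d.+1) * (d.+1%:R * B).
      by rewrite /C1; ring.
    by apply: lerD; apply: ler_pM.
  (* Stretching [[0, h]] to [[0, n]] brings in the integer nodes of [poly_coef_bound]. Having degree
     at most [2d], the polynomial grows at most by a factor of order [(n / h) ^+ (2d)] out to
     distance 1, and two powers of [h] remain. *)
  pose pt := Pi \Po ((h / n%:R) *: 'X).
  have ptE t : pt.[t] = Pi.[h / n%:R * t] by rewrite horner_comp !hornerE.
  have szpt : (size pt <= n)%N.
    by rewrite /pt size_comp_poly2// size_scale ?size_polyX// gt_eqF// divr_gt0.
  have coefpt := HK0 pt (C1 * h ^+ (d.+1 + d.+1)) szpt.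
  have {}coefpt j : `|pt`_j| <= K0 * (C1 * h ^+ (d.+1 + d.+1)).
    apply: coefpt => i; rewrite ptE; apply: Pis.
    rewrite mulr_ge0 ?divr_ge0 ?(ltW h0)//= mulrAC ler_pdivrMr//.
    by rewrite ler_wpM2l ?(ltW h0)// ler_nat ltnW.
  have h1 : h <= 1 by apply: le_trans dl1.
  have nh1 : 1 <= n%:R / h.
    by rewrite ler_pdivlMr// mul1r (le_trans h1)// ler1n.
  have PiX : `|Pi.[X - x]| <= n%:R * (K0 * C1) * n%:R ^+ (d + d) * h ^+ 2.
    have -> : Pi.[X - x] = pt.[(X - x) * (n%:R / h)].
      by rewrite ptE; congr (Pi.[_]); field; rewrite !gt_eqF.
    rewrite (horner_coef_wide _ szpt); apply: le_trans (ler_norm_sum _ _ _) _.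
    have Xx : `|X - x| <= 1 by apply: le_trans (dist _ _ xI XI) dl1.
    apply: (@le_trans _ _ (\sum_(i < n) K0 * (C1 * h ^+ (d.+1 + d.+1)) * (n%:R / h) ^+ (d + d))).
      apply: ler_sum => i _; rewrite normrM normrX normrM; apply: ler_pM => //.
      have nh0 : 0 <= n%:R / h by rewrite divr_ge0// ltW.
      apply: (@le_trans _ _ ((n%:R / h) ^+ i)).
        rewrite (ger0_norm nh0); apply: lerXn2r.
        - by rewrite nnegrE mulr_ge0.
        - by rewrite nnegrE.
        - by rewrite ler_piMl.
      by apply: ler_weXn2l => //; rewrite -ltnS.
    have -> : h ^+ (d.+1 + d.+1) = h ^+ 2 * h ^+ (d + d).
      by rewrite -exprD addnS addSn.
    rewrite sumr_const card_ord -[leLHS]mulr_natl expr_div_n.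
    have Hne : h ^+ (d + d) != 0 by rewrite expf_neq0 ?gt_eqF.
    move: (h ^+ (d + d)) Hne => H Hne.
    rewrite le_eqVlt; apply/orP; left; apply/eqP.
    by field.
  have qx := Qlow x (X - x) (hi'hi _ xI) (dist _ _ xI XI).
  have qy := Qlow y (X - y) (hi'hi _ yI) (dist _ _ yI XI).
  have w20 : 0 < w / 2 by rewrite divr_gt0.
  have qx0 : (Q x).[X - x] != 0 by rewrite -normr_gt0 (lt_le_trans w20).
  have qy0 : (Q y).[X - y] != 0 by rewrite -normr_gt0 (lt_le_trans w20).
  have -> : Rf y X - Rf x X = - (Pi.[X - x] / ((Q x).[X - x] * (Q y).[X - y])).
    rewrite PiE /Rf; have -> : X - x - h = X - y by rewrite /h; ring.
    by field; rewrite qx0 qy0.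
  rewrite normrN normrM normfV normrM ler_pdivrMr; last first.
    by rewrite mulr_gt0// normr_gt0.
  apply: le_trans PiX _; rewrite -/h /K.
  set A := n%:R * _ * _.
  have A0 : 0 <= A.
    by apply: mulr_ge0; [apply: mulr_ge0 => //; apply: mulr_ge0|apply: exprn_ge0].
  have -> : A / (w / 2) ^+ 2 * h ^+ 2 * (`|(Q x).[X - x]| * `|(Q y).[X - y]|) =
     A * h ^+ 2 * ((`|(Q x).[X - x]| * `|(Q y).[X - y]|) / (w / 2) ^+ 2) by ring.
  apply: ler_peMr; first by apply: mulr_ge0 => //; apply: exprn_ge0; exact: ltW.
  rewrite ler_pdivlMr ?exprn_gt0// mul1r expr2.
  by apply: ler_pM => //; exact: ltW.
have loI : lo <= lo <= hi' by rewrite lexx ltW.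
have QX X : lo <= X <= hi' -> (Q lo).[X - lo] != 0.
  move=> XI; rewrite -normr_gt0 (@lt_le_trans _ _ (w / 2)) ?divr_gt0//.
  by apply: Qlow; [exact: hi'hi|exact: dist].
exists (P lo \Po ('X - lo%:P)), (Q lo \Po ('X - lo%:P)), hi'; split => // X XI.
rewrite !horner_comp !hornerE; split; first exact: QX.
(* At [z = 0] the remainder vanishes: the approximant centred at [X] is exact at [X]. *)
have fX : f X = Rf X X.
  have := rem X 0 (hi'hi _ XI); rewrite normr0 => /(_ (ltW k0)).
  rewrite addr0 addSn exprS mul0r mulr0 normr_le0 subr_eq0 => /eqP E.
  rewrite /Rf subrr E mulrAC divff ?mul1r// -normr_gt0.
  rewrite (@lt_le_trans _ _ (w / 2)) ?divr_gt0//.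
  by apply: Qlow; [exact: hi'hi|rewrite normr0 ltW].
rewrite fX -/(Rf lo X); have /andP[loX _] := XI.
move: loX; rewrite le_eqVlt => /orP[/eqP <-//|loX].
by rewrite -(holder2_const (hol X XI) loI XI loX).
Qed.

End RationalityCriterion.

(** * Identity theorem, nonvanishing of Toeplitz determinants, local bilipschitz bounds *)

Section IdentityTheorem.
Variable R : realType.
Implicit Types (f : R -> R) (U : set R).

Definition locally_zero f x := exists2 r : R, 0 < r & forall z, `|z| < r -> f (x + z) = 0.

Lemma germ_identity U f x1 : is_interval U ->
  (forall x, U x -> germ f x) -> U x1 -> locally_zero f x1 ->
  forall x, U x -> f x = 0.
Proof.
move=> /connected_intervalP cU gf Ux1 zx1.
pose Z := [set x | locally_zero f x].
have Zv x : Z x -> f x = 0.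
  by move=> [r r0 /(_ 0)]; rewrite normr0 addr0; apply.
move=> x Ux; have Zx : Z x; last exact: Zv.
suff UZ : U `&` Z = U by move: Ux; rewrite -UZ => -[].
apply: cU.
- by exists x1.
- exists Z => //; rewrite openE => y [r r0 Hr].
  apply/nbhs_ballP; exists (r / 2) => /=; first by rewrite divr_gt0.
  move=> t; rewrite /ball /= => yt; exists (r / 2); first by rewrite divr_gt0.
  move=> z zr; have -> : t + z = y + (t - y + z) by ring.
  apply: Hr; apply: le_lt_trans (ler_normD _ _) _; rewrite distrC; lra.
(* At a limit point of [Z] the lower bound of [germ_zero] would exclude nearby zeros, so only local
   vanishing is left. *)
- exists (closure Z); first exact: closed_closure.
  apply/seteqP; split=> [y [Uy Zy]|y [Uy cZ]]; split => //; first exact: subset_closure.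
  have [//|[r [mu [w [r0 w0 H]]]]] := germ_zero (gf y Uy).
  have /cZ[t [Zt yt]] : nbhs y (ball y r) by exact: nbhsx_ballx.
  have [<-//|ty] := eqVneq t y.
  have := H (t - y); rewrite subrKC (Zv _ Zt) normr0.
  move: yt; rewrite /ball /= distrC => yt /(_ yt).
  by rewrite leNgt mulr_gt0// exprn_gt0// normr_gt0 subr_eq0.
Qed.

Definition rational_on U f := exists p q : {poly R},
  [/\ q != 0, coprimep p q,
      (forall x, U x -> q.[x] != 0) &
      (forall x, U x -> f x = p.[x] / q.[x])].

(** The identity theorem is applied to [q' f - p'], which makes sense on all of [U] before poles are
    excluded. A zero of [q'] in [U] would then be one of [p'], against coprimality. *)
Lemma rational_extend U f (lo hi : R) (p q : {poly R}) : is_interval U ->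
  (forall x, U x -> germ f x) -> lo < hi ->
  (forall x, lo <= x <= hi -> U x) ->
  (forall x, lo <= x <= hi -> q.[x] != 0 /\ f x = p.[x] / q.[x]) ->
  rational_on U f.
Proof.
move=> iU gf lohi IU H.
have loI : lo <= lo <= hi by rewrite lexx ltW.
have q0 : q != 0.
  by apply/eqP => q0; have [] := H lo loI; rewrite q0 horner0 eqxx.
pose g := gcdp p q; pose p' := p %/ g; pose q' := q %/ g.
have pE : p' * g = p by rewrite divpK// dvdp_gcdl.
have qE : q' * g = q by rewrite divpK// dvdp_gcdr.
have cop : coprimep p' q' by rewrite coprimep_div_gcd// q0 orbT.
have F0 x : U x -> q'.[x] * f x - p'.[x] = 0.
  move=> Ux; pose F y := q'.[y] * f y + (- p').[y].
  have FF : forall y, U y -> germ F y.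
    move=> y Uy; apply: germD; last exact: germ_horner.
    by apply: germM; [exact: germ_horner|exact: gf].
  have mid : lo <= (lo + hi) / 2 <= hi by apply/andP; split; lra.
  have := germ_identity iU FF (IU _ mid); rewrite /F => /(_ _ x Ux).
  rewrite hornerN; apply; exists ((hi - lo) / 2); first by lra.
  move=> z zr; set y := _ + z.
  have yI : lo <= y <= hi.
    by move: zr; rewrite ltr_norml /y => /andP[? ?]; apply/andP; split; lra.
  have [qy fy] := H y yI; move: qy fy.
  rewrite -{1 2}qE -{1}pE !hornerM mulf_eq0 negb_or hornerN => /andP[q'0 g0] ->.
  by field; rewrite q'0 g0.
have q'U x : U x -> q'.[x] != 0.
  move=> Ux; apply/negP => q'x; have := F0 x Ux.
  rewrite (eqP q'x) mul0r sub0r => /eqP; rewrite oppr_eq0 => p'x.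
  by have := coprimep_root cop p'x; rewrite q'x.
exists p', q'; split => //.
  by apply/eqP => q'0; move: q0; rewrite -qE q'0 mul0r eqxx.
move=> x Ux; have := F0 x Ux => /eqP; rewrite subr_eq0 => /eqP <-.
by rewrite mulrAC divff ?mul1r// q'U.
Qed.

(** Induction on the order: by [toeplitz_cofactor] the lower bound for one determinant bounds the
    cofactor needed for the next, and if the next vanished near [x0], then [rational_of_toeplitz]
    would make [f] rational. The centre is left out because a determinant may vanish there. *)
Lemma toeplitz_nonzero U f x0 A : open U -> is_interval U ->
  (forall x, U x -> germ f x) -> ~ rational_on U f -> U x0 ->
  exists2 r, 0 < r & forall h, 0 < `|h| < r -> U (x0 + h) /\
    exists c M rho, taylor f (x0 + h) c M rho /\
      forall e, (e < A)%N -> \det (toeplitz c e) != 0.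
Proof.
move=> oU iU gf nrat Ux0.
have [a [M [rho Ta]]] := gf x0 Ux0; have rho0 := Ta.1.
have [b [M' [gb Tb]]] := taylor_recenter Ta.
have /nbhs_ballP[eU /= eU0 HU] : nbhs x0 U by apply: open_nbhs_nbhs.
have inU h : `|h| < eU -> U (x0 + h).
  by move=> he; apply: HU; rewrite /ball /= opprD addrA subrr add0r normrN.
pose G e h := \det (toeplitz (b^~ h) e).
have gG e : germ (G e) 0 by apply: germ_det => i j; apply: gb.
have lowG_of_cofactor d : (exists r mu w, [/\ 0 < r, 0 < w & forall h, `|h| < r ->
      w * `|h| ^+ mu <= `|cofactor (toeplitz (b^~ h) d) ord_max ord0|]) ->
    exists r mu w, [/\ 0 < r, 0 < w &
     forall h, `|h| < r -> w * `|h| ^+ mu <= `|G d h|].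
  move=> [r' [mu [w [r'0 w0 H']]]].
  have [[r1 r10 H1]|[r [mu' [w' [r0 w'0 H]]]]] := germ_zero (gG d); last first.
    by exists r, mu', w'; split => // h hr; rewrite -[h in G _ h]add0r H.
  exfalso; apply: nrat.
  (* The interval from [x0 + s / 2] to [x0 + s] avoids the centre, where the cofactor may vanish; on
     it the cofactor is at least [w * (s / 2) ^+ mu]. *)
  pose s := Num.min (Num.min (Num.min r1 r') (rho / 8)) eU / 2.
  have m0 : 0 < Num.min (Num.min (Num.min r1 r') (rho / 8)) eU.
    by rewrite !lt_min r10 r'0 eU0 divr_gt0.
  have [sr1 sr' srho sU] : [/\ s < r1, s < r', s < rho / 8 & s < eU].
    have : s < Num.min (Num.min (Num.min r1 r') (rho / 8)) eU by rewrite /s; lra.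
    by rewrite !lt_min -!andbA => /and4P.
  have s0 : 0 < s by rewrite divr_gt0.
  have hs x : x0 + s / 2 <= x <= x0 + s -> s / 2 <= `|x - x0| <= s.
    by move=> /andP[? ?]; rewrite ger0_norm; [apply/andP; split; lra|lra].
  have [p [q [hi' [lohi' H]]]] : exists (p q : {poly R}) (hi' : R),
      x0 + s / 2 < hi' /\ forall x, x0 + s / 2 <= x <= hi' ->
        q.[x] != 0 /\ f x = p.[x] / q.[x].
    apply: (@rational_of_toeplitz _ f (x0 + s / 2) (x0 + s) M' (rho / 4)
       (w * (s / 2) ^+ mu) (fun x => b^~ (x - x0)) d) => //.
    - by lra.
    - by rewrite divr_gt0.
    - by rewrite mulr_gt0// exprn_gt0// divr_gt0.
    - move=> x /hs/andP[_ xs]; have := Tb (x - x0); rewrite subrKC; apply.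
      by apply: le_trans xs _; exact: ltW.
    - move=> x /hs/andP[_ xs]; have := H1 (x - x0); rewrite add0r; apply.
      exact: le_lt_trans xs _.
    - move=> x /hs/andP[xs1 xs]; apply: le_trans (H' (x - x0) (le_lt_trans xs sr')).
      apply: ler_wpM2l; first exact: ltW.
      by apply: lerXn2r => //; rewrite nnegrE divr_ge0// ltW.
  pose hi2 := Num.min hi' (x0 + s).
  apply: (@rational_extend U f (x0 + s / 2) hi2 p q) => //.
  - by rewrite lt_min lohi'; lra.
  - move=> x /andP[x1]; rewrite le_min => /andP[_ x2].
    rewrite -(subrKC x0 x); apply: inU.
    have /andP[_ h] : s / 2 <= `|x - x0| <= s by apply: hs; rewrite x1.
    exact: le_lt_trans h sU.
  - by move=> x /andP[x1]; rewrite le_min => /andP[x2 _]; apply: H; rewrite x1.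
have lowG e : exists r mu w, [/\ 0 < r, 0 < w &
     forall h, `|h| < r -> w * `|h| ^+ mu <= `|G e h|].
  elim: e => [|e IH].
    (* For [d = 0] the cofactor is an empty determinant, equal to 1. *)
    have cof : exists r mu w, [/\ 0 < r, 0 < w & forall h, `|h| < r ->
        w * `|h| ^+ mu <= `|cofactor (toeplitz (b^~ h) 0) ord_max ord0|].
      exists 1, 0%N, 1; split => // h _.
      by rewrite expr0 mulr1 /cofactor det_mx00 mulr1 expr0 normr1.
    exact: lowG_of_cofactor.
  have cof : exists r mu w, [/\ 0 < r, 0 < w & forall h, `|h| < r ->
      w * `|h| ^+ mu <= `|cofactor (toeplitz (b^~ h) e.+1) ord_max ord0|].
    have [r [mu [w [r0 w0 H]]]] := IH; exists r, mu, w; split => // h /H.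
    by rewrite toeplitz_cofactor normrM normrX normrN normr1 expr1n mul1r.
  exact: lowG_of_cofactor.
have [r r0 Hr] : exists2 r, 0 < r & forall h, 0 < `|h| < r ->
    forall e, (e < A)%N -> G e h != 0.
  elim: A => [|A [r r0 IH]]; first by exists 1.
  have [r' [mu [w [r'0 w0 H]]]] := lowG A.
  exists (Num.min r r'); first by rewrite lt_min r0.
  move=> h /andP[h0]; rewrite lt_min => /andP[hr hr'] e.
  rewrite ltnS leq_eqVlt => /orP[/eqP ->|eA].
    rewrite -normr_gt0; apply: lt_le_trans (H _ hr').
    by rewrite mulr_gt0// exprn_gt0.
  by apply: IH => //; rewrite h0.
exists (Num.min (Num.min r eU) (rho / 8)).
  by rewrite !lt_min r0 eU0 divr_gt0.
move=> h /andP[h0]; rewrite !lt_min -andbA => /and3P[hr hU hrho].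
split; first exact: inU.
exists (b^~ h), M', (rho / 4); split; first by apply: Tb; exact: ltW.
by move=> e eA; apply: Hr => //; rewrite h0.
Qed.

(** The increment of [f] differs from [c 1 * (y - y')] by at most half of it: each
    [z ^+ n - z' ^+ n] has the factor [z - z'], and a small radius makes the terms with [n >= 2]
    small. *)
Lemma taylor_bilipschitz f x c M rho : taylor f x c M rho -> c 1%N != 0 ->
  exists r l L, [/\ 0 < r, 0 < l, 0 < L & forall y y', `|y - x| <= r -> `|y' - x| <= r ->
    l * `|y - y'| <= `|f y - f y'| <= L * `|y - y'|].
Proof.
move=> T c1; have M0 := taylor_ge0 T; have [rho0 H] := T.
have c10 : 0 < `|c 1%N| by rewrite normr_gt0.
pose s := Num.min (rho / 4) (`|c 1%N| * rho ^+ 2 / (16 * (M + 1))).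
have s0 : 0 < s by rewrite lt_min divr_gt0//= divr_gt0// ?mulr_gt0 ?exprn_gt0//; lra.
have [s1 s2] : s <= rho / 4 /\ s <= `|c 1%N| * rho ^+ 2 / (16 * (M + 1)).
  by split; rewrite ge_min lexx ?orbT.
exists s, (`|c 1%N| / 2), (2 * `|c 1%N|); split => //; [by rewrite divr_gt0|by rewrite mulr_gt0|].
move=> y y' ys y's; pose z := y - x; pose z' := y' - x.
have zz : z - z' = y - y' by rewrite /z /z'; ring.
have key : `|f y - f y' - c 1%N * (z - z')| <= `|c 1%N| / 2 * `|z - z'|.
  apply: (@le_add_geometric _ _ _ (2 * M) (4^-1)); first by lra.
  move=> K; pose S w := \sum_(n < K.+2) c n * w ^+ n.
  have trunc w : `|w| <= s -> `|f (x + w) - S w| <= M * 4^-1 ^+ K.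
    move=> ws; have wr : `|w| <= rho / 4 by apply: le_trans s1.
    apply: le_trans (H K.+2 w _) _; first by apply: le_trans wr _; lra.
    apply: ler_wpM2l => //; apply: (@le_trans _ _ (4^-1 ^+ K.+2)).
      apply: lerXn2r; rewrite ?nnegrE//; last by rewrite ler_pdivrMr//; lra.
      by rewrite divr_ge0// ltW.
    by apply: ler_wiXn2l; rewrite ?leqW//; lra.
  have pw n : `|z ^+ n.+1 - z' ^+ n.+1| <= `|z - z'| * (2 * s) ^+ n.
    rewrite subrXX normrM; apply: ler_wpM2l => //.
    apply: le_trans (ler_norm_sum _ _ _) _.
    apply: (@le_trans _ _ (\sum_(i < n.+1) s ^+ n)).
      apply: ler_sum => i _; rewrite normrM !normrX.
      have ni : (i <= n)%N by rewrite -ltnS.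
      rewrite -[X in _ <= s ^+ X](subnK ni) exprD.
      have sg := ltW s0.
      by apply: ler_pM; rewrite ?exprn_ge0//; apply: lerXn2r; rewrite ?nnegrE// subSS.
    rewrite sumr_const card_ord -[leLHS]mulr_natl exprMn; apply: ler_wpM2r.
      by rewrite exprn_ge0// ltW.
    by rewrite -natrX ler_nat ltn_expl.
  have SS : `|S z - S z' - c 1%N * (z - z')| <= `|c 1%N| / 2 * `|z - z'|.
    rewrite /S !big_ord_recl /= !expr0 !expr1.
    set A := \sum_(i < K) _; set B := \sum_(i < K) _.
    rewrite (_ : _ - _ - _ = A - B); last by ring.
    rewrite -sumrB; apply: le_trans (ler_norm_sum _ _ _) _.
    pose t := 2 * s / rho.
    have t2 : 0 <= t <= 2^-1.
      rewrite /t; apply/andP; split; first by rewrite divr_ge0 ?mulr_ge0// ltW.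
      by rewrite ler_pdivrMr//; lra.
    apply: (@le_trans _ _ (\sum_(1 <= n < K.+1) (2 * M / rho * `|z - z'|) * t ^+ n)).
      rewrite big_add1 /= big_mkord; apply: ler_sum => i _.
      rewrite /bump /= !add1n -mulrBr normrM.
      have -> : 2 * M / rho * `|z - z'| * t ^+ i.+1 =
         (2 * M / rho ^+ i.+2) * (`|z - z'| * (2 * s) ^+ i.+1).
        rewrite /t expr_div_n (exprS rho i.+1).
        have re : rho ^+ i.+1 != 0 by rewrite expf_neq0// gt_eqF.
        move: (rho ^+ i.+1) re => re re0; move: ((2 * s) ^+ i.+1) => u.
        by field; rewrite re0 gt_eqF.
      by apply: ler_pM => //; exact: taylor_coef T.
    rewrite -mulr_sumr.
    apply: (@le_trans _ _ (2 * M / rho * `|z - z'| * (2 * t))).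
      apply: ler_wpM2l; first by rewrite mulr_ge0// divr_ge0 ?mulr_ge0// ltW.
      by have := geometric_sum_le 1 K.+1 t2; rewrite expr1.
    rewrite (_ : _ * _ * _ = (2 * M / rho * (2 * t)) * `|z - z'|); last by ring.
    apply: ler_wpM2r => //; rewrite /t.
    have -> : 2 * M / rho * (2 * (2 * s / rho)) = 8 * M * s / rho ^+ 2.
      by field; rewrite gt_eqF.
    rewrite ler_pdivrMr ?exprn_gt0//.
    move: s2; rewrite ler_pdivlMr; last by rewrite mulr_gt0//; lra.
    have : 0 <= s by exact: ltW.
    move: (rho ^+ 2) => r2; nra.
  have e1 := trunc z ys; have e2 := trunc z' y's.
  rewrite /z /z' !subrKC -/z -/z' in e1 e2.
  rewrite (_ : _ - _ - _ = (f y - S z) - (f y' - S z') + (S z - S z' - c 1%N * (z - z'))); last by ring.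
  apply: le_trans (ler_normD _ _) _.
  apply: le_trans (lerD (ler_normB _ _) (lexx _)) _.
  lra.
rewrite zz in key.
have k1 := ler_normD (f y - f y') (- (f y - f y' - c 1%N * (y - y'))).
have k2 := ler_normD (f y - f y' - c 1%N * (y - y')) (c 1%N * (y - y')).
move: k1 k2; rewrite subrK normrN opprB addrC subrK normrM => k1 k2.
by apply/andP; split; have := normr_ge0 (y - y'); lra.
Qed.

End IdentityTheorem.

(** * Perturbation of determinants, affine substitutions, integer determinants *)

Section DeterminantEstimates.
Variable R : realType.

Lemma prod_perturb n (a b : 'I_n -> R) (B dl : R) : 1 <= B ->
  (forall i, `|a i| <= B) -> (forall i, `|b i| <= B) ->
  (forall i, `|a i - b i| <= dl) ->
  `|\prod_i a i - \prod_i b i| <= n%:R * B ^+ n * dl.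
Proof.
move=> B1; have B0 : 0 <= B by apply: le_trans B1.
elim: n a b => [|n IH] a b aB bB ab; first by rewrite !big_ord0 subrr normr0 !mul0r.
rewrite !big_ord_recr/=; set p := \prod_(i < n) a _; set q := \prod_(i < n) b _.
have -> : p * a ord_max - q * b ord_max =
  (p - q) * a ord_max + q * (a ord_max - b ord_max) by ring.
have dl0 : 0 <= dl by apply: le_trans (ab ord_max).
apply: le_trans (ler_normD _ _) _; rewrite !normrM.
have h1 : `|p - q| * `|a ord_max| <= (n%:R * B ^+ n * dl) * B.
  by apply: ler_pM => //; apply: IH.
have h2 : `|q| * `|a ord_max - b ord_max| <= B ^+ n.+1 * dl.
  apply: ler_pM => //; rewrite normr_prod; apply: (@le_trans _ _ (B ^+ n)).
    rewrite -[X in _ ^+ X]card_ord -prodr_const; apply: ler_prod => i _.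
    by rewrite normr_ge0 bB.
  exact: ler_weXn2l.
rewrite -natr1; move: h1 h2; rewrite exprS; lra.
Qed.

Lemma det_perturb n (T : 'M[R]_n) (e : R) : 0 < e -> exists2 dl, 0 < dl &
  forall X : 'M[R]_n, (forall i j, `|X i j| <= dl) -> `|\det (T + X) - \det T| <= e.
Proof.
move=> e0; pose B := \sum_i \sum_j `|T i j| + 2.
have S0 : 0 <= \sum_i \sum_j `|T i j| by apply: sumr_ge0 => i _; apply: sumr_ge0.
have TB i j : `|T i j| <= B - 1.
  rewrite /B (bigD1 i)//= (bigD1 j)//=.
  have h1 : 0 <= \sum_(i0 < n | i0 != i) \sum_j0 `|T i0 j0|.
    by apply: sumr_ge0 => k _; apply: sumr_ge0.
  have h2 : 0 <= \sum_(i0 < n | i0 != j) `|T i i0| by apply: sumr_ge0.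
  lra.
pose K := #|{: 'S_n}|%:R * (n%:R * B ^+ n) + 1.
have K0 : 0 < K.
  rewrite ltr_wpDl// !mulr_ge0// exprn_ge0//; rewrite /B; lra.
exists (Num.min 1 (e / K)); first by rewrite lt_min ltr01 divr_gt0.
set dl := Num.min _ _ => X HX.
have dl0 : 0 < dl by rewrite lt_min ltr01 divr_gt0.
have dl1 : dl <= 1 by rewrite ge_min lexx.
have dlK : K * dl <= e by rewrite mulrC -ler_pdivlMr// ge_min lexx orbT.
apply: le_trans dlK; rewrite /determinant -sumrB.
apply: le_trans (ler_norm_sum _ _ _) _.
apply: (@le_trans _ _ (\sum_(s : 'S_n) n%:R * B ^+ n * dl)).
  apply: ler_sum => s _; rewrite -mulrBr normrM normrX normrN normr1 expr1n mul1r.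
  apply: prod_perturb; first by rewrite /B; lra.
  - move=> i; rewrite mxE; apply: le_trans (ler_normD _ _) _.
    by have := TB i (s i); have := HX i (s i); lra.
  - by move=> i; have := TB i (s i); lra.
  - by move=> i; rewrite mxE addrAC subrr add0r.
rewrite sumr_const -[leLHS]mulr_natl mulrA; apply: ler_wpM2r; first exact: ltW.
by rewrite /K lerDl.
Qed.

(** The substitution [th + v * w] on monomials: column [m] expands the [m]-th power, so the matrix
    is upper triangular with diagonal entries [v ^+ m]. *)
Definition affine_mx n (th v : R) : 'M[R]_n :=
  \matrix_(k, m) (th ^+ (m - k) * v ^+ k *+ 'C(m, k)).

Lemma affine_mxE n (th v w : R) (m : 'I_n) :
  (th + v * w) ^+ m = \sum_(k < n) w ^+ k * affine_mx n th v k m.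
Proof.
rewrite (binomial_widen th (v * w) m (n - m.+1)) subnKC// big_mkord.
apply: eq_bigr => k _; rewrite mxE mulrnAr exprMn; congr (_ *+ _).
by rewrite [RHS]mulrC mulrA.
Qed.

Lemma det_affine_mx n (th v : R) : \det (affine_mx n th v) = v ^+ (\sum_(k < n) k).
Proof.
rewrite -det_tr det_trig; last first.
  by apply/is_trig_mxP => i j ij; rewrite !mxE bin_small.
under eq_bigr do rewrite !mxE subnn expr0 mul1r binn mulr1n.
by rewrite -expr_sum.
Qed.

Lemma affine_mx_bound n (th v : R) k m : 0 <= th <= 1 -> 1 <= v ->
  `|affine_mx n th v k m| <= 2 ^+ n * v ^+ n.-1.
Proof.
move=> /andP[th0 th1] v1; have v0 : 0 <= v by apply: le_trans v1.
rewrite mxE normrMn normrM !normrX (ger0_norm th0) (ger0_norm v0) -[leLHS]mulr_natl.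
apply: ler_pM => //; first by rewrite mulr_ge0 ?exprn_ge0.
  rewrite -natrX ler_nat (leq_trans (bin_le_expn _ _))// leq_pexp2l//.
  exact: ltnW.
rewrite -[leRHS]mul1r; apply: ler_pM; rewrite ?exprn_ge0//.
  exact: exprn_ile1.
by apply: ler_weXn2l => //; case: n k m => [[]//|n] k m; rewrite -ltnS.
Qed.

(** The excess [e.+1 ^ 2] is the power of [v] gained in [cluster_det]: one block of [2e + 2]
    monomials against two blocks of [e + 1]. *)
Lemma sum_ord_square e :
  (\sum_(k < e.+1 + e.+1) k = \sum_(k < e.+1) k + \sum_(k < e.+1) k + e.+1 ^ 2)%N.
Proof.
rewrite big_split_ord/= big_split/= sum_nat_const card_ord; lia.
Qed.

Lemma det_int_ge1 n (A : 'M[R]_n) : (forall i j, exists z : int, A i j = z%:~R) ->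
  \det A != 0 -> 1 <= `|\det A|.
Proof.
move=> H; have /choice[F HF] : forall ij : 'I_n * 'I_n, exists z : int, A ij.1 ij.2 = z%:~R.
  by move=> [i j]; apply: H.
have -> : A = map_mx intr (\matrix_(i, j) F (i, j)).
  by apply/matrixP => i j; rewrite !mxE (HF (i, j)).
rewrite det_map_mx intr_eq0 -intr_norm => d0.
by rewrite (_ : 1 = 1%:~R)// ler_int -gtz0_ge1 normr_gt0.
Qed.

End DeterminantEstimates.

(** * The interpolation determinant of a cluster of nodes *)

Section ClusterDeterminant.
Variable R : realType.

(** The linear system for polynomials P, Q of degree at most [e] with P + y Q = 0 at all [2e + 2]
    nodes, that is, for rational interpolation. *)
Definition interp_mx e (nd y : 'I_(e.+1 + e.+1) -> R) : 'M[R]_(e.+1 + e.+1) :=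
  row_mx (\matrix_(i, j) nd i ^+ j) (\matrix_(i, j) (y i * nd i ^+ j)).

Lemma interp_mx_affine e (nd w y : 'I_(e.+1 + e.+1) -> R) (th v : R) :
  (forall i, nd i = th + v * w i) ->
  interp_mx nd y =
    interp_mx w y *m block_mx (affine_mx e.+1 th v) 0 0 (affine_mx e.+1 th v).
Proof.
move=> H; rewrite mul_row_block !mulmx0 addr0 add0r; congr row_mx.
  apply/matrixP => i j; rewrite !mxE H affine_mxE.
  by apply: eq_bigr => k _; rewrite !mxE.
apply/matrixP => i j; rewrite !mxE H affine_mxE mulr_sumr.
by apply: eq_bigr => k _; rewrite [in RHS]mxE mulrA.
Qed.

(** With [f] cut at order [2e + 2], the matrix of its values at the [x + w i] is the matrix of
    powers of the [w i] times this one, up to terms of order [2e + 2]; its determinant is that of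
    [toeplitz c e]. *)
Definition taylor_mx (c : nat -> R) e : 'M[R]_(e.+1 + e.+1) :=
  block_mx 1%:M (\matrix_(n, j) shifted c n j) 0 (toeplitz c e).

Lemma interp_mx_error e (f : R -> R) x c M rho (w y : 'I_(e.+1 + e.+1) -> R) eta :
  taylor f x c M rho -> (forall i, `|w i| <= 1) -> (forall i, `|w i| <= rho) ->
  (forall i, `|y i - f (x + w i)| <= eta) ->
  forall i j, `|(interp_mx w y - (\matrix_(i, m) w i ^+ m) *m taylor_mx c e) i j| <=
     eta + M * (1 + rho) ^+ (e.+1) * (`|w i| / rho) ^+ (e.+1 + e.+1).
Proof.
move=> T w1 wr wy i j; have M0 := taylor_ge0 T; have r0 := T.1.
have eta0 : 0 <= eta by apply: le_trans (wy i).
pose Wl : 'M[R]_(e.+1 + e.+1, e.+1) := \matrix_(i, m) w i ^+ m.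
pose Wr : 'M[R]_(e.+1 + e.+1, e.+1) := \matrix_(i, m) w i ^+ (e.+1 + m).
have -> : (\matrix_(i, m) w i ^+ m : 'M[R]_(e.+1 + e.+1)) = row_mx Wl Wr.
  apply/matrixP => a b; rewrite !mxE; case: split_ordP => k ->; rewrite mxE //.
rewrite /taylor_mx mul_row_block mulmx1 mulmx0 addr0 /interp_mx opp_row_mx add_row_mx mxE.
have rhs0 : 0 <= eta + M * (1 + rho) ^+ e.+1 * (`|w i| / rho) ^+ (e.+1 + e.+1).
  rewrite addr_ge0// !mulr_ge0// exprn_ge0//; first by rewrite addr_ge0// ltW.
  by rewrite divr_ge0// ltW.
case: split_ordP => k _; first by rewrite !mxE subrr normr0.
rewrite !mxE.
have -> : \sum_j0 Wl i j0 * (\matrix_(n, j1) shifted c n j1) j0 k +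
   \sum_j0 Wr i j0 * toeplitz c e j0 k =
   \sum_(n < e.+1 + e.+1) shifted c n k * w i ^+ n.
  rewrite big_split_ord/=; congr (_ + _); apply: eq_bigr => n _; rewrite !mxE mulrC//.
  by rewrite /shifted (leq_trans (ltnW (ltn_ord k))) ?leq_addr.
have -> : y i * w i ^+ k - \sum_(n < e.+1 + e.+1) shifted c n k * w i ^+ n =
   (y i - f (x + w i)) * w i ^+ k +
   (w i ^+ k * f (x + w i) - \sum_(n < e.+1 + e.+1) shifted c n k * w i ^+ n) by ring.
apply: le_trans (ler_normD _ _) _; apply: lerD.
  rewrite normrM normrX -[leRHS]mulr1; apply: ler_pM => //; exact: exprn_ile1.
apply: le_trans (taylor_shifted T _ (wr i)) _.
  by rewrite (leq_trans (ltnW (ltn_ord k))) ?leq_addr.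
apply: ler_wpM2r; first by rewrite exprn_ge0// divr_ge0// ltW.
apply: ler_wpM2l => //; apply: (@le_trans _ _ ((1 + rho) ^+ k)).
  by apply: lerXn2r; rewrite ?nnegrE ?addr_ge0 ?(ltW r0)// lerDr.
by apply: ler_weXn2l; [rewrite lerDl ltW|exact: ltnW].
Qed.

(** In the variables [w i = (nd i - th) / v] the matrix is [W *m (Tm + X)] times two blocks
    [affine_mx]. Eliminating [\det W] through the fixed Vandermonde determinant [\det Np] leaves
    [v ^- (e.+1 ^ 2)]. *)
Lemma cluster_det (f : R -> R) x c M rho e (nd : 'I_(e.+1 + e.+1) -> nat) (k : nat) :
  taylor f x c M rho -> \det (toeplitz c e) != 0 -> injective nd ->
  (forall i, (nd i < k)%N) ->
  exists eps K : R, 0 < eps /\ forall (v th eta : R) (y : 'I_(e.+1 + e.+1) -> R),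
    1 <= v -> k%:R <= v -> k%:R <= rho * v -> 0 <= th <= 1 ->
    (forall i, `|y i - f (x + ((nd i)%:R - th) / v)| <= eta) ->
    v ^+ (e.+1 + e.+1).-1 * (eta + v ^- (e.+1 + e.+1)) <= eps ->
    \det (interp_mx (fun i => (nd i)%:R) y) != 0 /\
    `|\det (interp_mx (fun i => (nd i)%:R) y)| <= K / v ^+ (e.+1 ^ 2)%N.
Proof.
move=> T tz injn ndk; have M0 := taylor_ge0 T; have r0 := T.1.
set D := (e.+1 + e.+1)%N in nd injn ndk *.
pose Np : 'M[R]_D := \matrix_(i, m) (nd i)%:R ^+ m.
have NpV : Np = (Vandermonde D (\row_i (nd i)%:R))^T.
  by apply/matrixP => i j; rewrite !mxE.
have Np0 : \det Np != 0.
  rewrite NpV det_tr det_Vandermonde; apply/prodf_neq0 => i _.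
  apply/prodf_neq0 => j ij; rewrite !mxE subr_eq0 eqr_nat.
  by apply/eqP => /injn ji; move: ij; rewrite ji ltnn.
have Npu : Np \in unitmx by rewrite unitmxE unitfE.
pose Tm := taylor_mx c e.
have detT : \det Tm = \det (toeplitz c e) by rewrite det_ublock det1 mul1r.
have t0 : 0 < `|\det Tm| / 2 by rewrite divr_gt0// normr_gt0 detT.
have [dl dl0 Hdl] := det_perturb Tm t0.
pose K1 := \sum_i \sum_j `|invmx Np i j|.
have K10 : 0 <= K1 by apply: sumr_ge0 => i _; apply: sumr_ge0.
have invK i j : `|invmx Np i j| <= K1.
  rewrite /K1 (bigD1 i)//= (bigD1 j)//= -addrA lerDl addr_ge0//.
    by apply: sumr_ge0.
  by apply: sumr_ge0 => l _; apply: sumr_ge0.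
pose C := 1 + M * (1 + rho) ^+ e.+1 * (k%:R / rho) ^+ D.
have C1 : 1 <= C.
  rewrite lerDl !mulr_ge0// ?exprn_ge0 ?divr_ge0 ?addr_ge0 ?(ltW r0)//.
pose K2 := D%:R * (D%:R * (2 ^+ D * K1 * C)) + 1.
have K20 : 0 < K2.
  rewrite ltr_wpDl// !mulr_ge0// ?exprn_ge0//; lra.
exists (dl / K2), (`|\det Np| * (2 * `|\det Tm|)); split; first by rewrite divr_gt0.
move=> v th eta y v1 kv krv th01 Hy Hv.
have v0 : 0 < v by apply: lt_le_trans v1.
pose w i := ((nd i)%:R - th) / v.
have eta0 : 0 <= eta.
  have i0 : 'I_D by exact: ord0.
  exact: le_trans (Hy i0).
have wk i : `|w i| <= k%:R / v.
  rewrite /w normrM normfV (gtr0_norm v0); apply: ler_wpM2r.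
    by rewrite invr_ge0 ltW.
  case/andP: th01 => th0 th1.
  have nk : (nd i)%:R + 1 <= k%:R :> R by rewrite natr1 ler_nat.
  have n0 : 0 <= (nd i)%:R :> R by [].
  rewrite ler_norml; apply/andP; split; lra.
have w1 i : `|w i| <= 1 by apply: le_trans (wk i) _; rewrite ler_pdivrMr// mul1r.
have wr i : `|w i| <= rho by apply: le_trans (wk i) _; rewrite ler_pdivrMr.
pose W : 'M[R]_D := \matrix_(i, m) w i ^+ m.
pose UD := affine_mx D th v.
have ndw i : (nd i)%:R = th + v * w i :> R.
  by rewrite /w; field; rewrite gt_eqF.
have NpW : Np = W *m UD.
  apply/matrixP => i j; rewrite !mxE ndw affine_mxE.
  by apply: eq_bigr => l _; rewrite !mxE.
pose E := interp_mx w y - W *m Tm.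
(* Since [Np = W *m UD], this is the inverse of [W] applied to [E]. Only [UD] grows with [v], at
   most like [v ^+ (2e + 1)]: hence the factor in the smallness hypothesis. *)
pose X := UD *m invmx Np *m E.
have WX : W *m (Tm + X) = interp_mx w y.
  by rewrite mulmxDr /X !mulmxA -NpW mulmxV// mul1mx /E addrC subrK.
pose ep := eta + M * (1 + rho) ^+ e.+1 * ((k%:R / v) / rho) ^+ D.
have Eb i j : `|E i j| <= C * (eta + v ^- D).
  apply: le_trans (interp_mx_error T w1 wr Hy i j) _.
  apply: (@le_trans _ _ ep).
    rewrite lerD2l; apply: ler_wpM2l.
      by rewrite mulr_ge0// exprn_ge0// addr_ge0// ltW.
    apply: lerXn2r; rewrite ?nnegrE ?divr_ge0 ?(ltW r0) ?(ltW v0)//.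
    by apply: ler_wpM2r; [rewrite invr_ge0 ltW|exact: wk].
  have -> : ep = eta + (C - 1) * v ^- D.
    rewrite /ep /C (_ : k%:R / v / rho = (k%:R / rho) / v); last by ring.
    by rewrite (expr_div_n (k%:R / rho)); ring.
  have := exprn_ge0 D (ltW v0); rewrite -invr_ge0.
  move: (v ^- D) C1 eta0 => u; nra.
have Xb i j : `|X i j| <= dl.
  apply: (@le_trans _ _ (K2 * (v ^+ D.-1 * (eta + v ^- D)))); last first.
    by rewrite mulrC -ler_pdivlMr.
  have vD0 : 0 <= v ^- D by rewrite invr_ge0 exprn_ge0// ltW.
  have ev : 0 <= v ^+ D.-1 * (eta + v ^- D).
    by rewrite mulr_ge0 ?addr_ge0// exprn_ge0// ltW.
  apply: (@le_trans _ _ (D%:R * (D%:R * (2 ^+ D * K1 * C)) * (v ^+ D.-1 * (eta + v ^- D)))); last first.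
    by apply: ler_wpM2r => //; rewrite lerDl.
  rewrite /X mxE; apply: le_trans (ler_norm_sum _ _ _) _.
  apply: (@le_trans _ _ (\sum_(l < D) (D%:R * (2 ^+ D * v ^+ D.-1 * K1)) * (C * (eta + v ^- D)))).
    apply: ler_sum => l _; rewrite normrM; apply: ler_pM => //.
    rewrite mxE; apply: le_trans (ler_norm_sum _ _ _) _.
    rewrite mulr_natl -[X in _ *+ X]card_ord -sumr_const.
    apply: ler_sum => m _; rewrite normrM; apply: ler_pM => //.
    exact: affine_mx_bound.
  rewrite sumr_const card_ord -[leLHS]mulr_natl le_eqVlt; apply/orP; left.
  by apply/eqP; ring.
have detb := Hdl X Xb.
have dTX : `|\det Tm| / 2 <= `|\det (Tm + X)| <= 2 * `|\det Tm|.
  have h1 := ler_normD (\det (Tm + X) - \det Tm) (\det Tm).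
  have h2 := ler_normB (\det (Tm + X)) (\det (Tm + X) - \det Tm).
  rewrite subrK in h1; rewrite opprB subrKC in h2.
  apply/andP; split; lra.
have detA : \det (interp_mx (fun i => (nd i)%:R) y) =
   \det W * \det (Tm + X) * (v ^+ (\sum_(l < e.+1) l) * v ^+ (\sum_(l < e.+1) l)).
  rewrite (interp_mx_affine y ndw) det_mulmx det_ublock !det_affine_mx -WX.
  by rewrite det_mulmx.
have detW : \det Np = \det W * v ^+ (\sum_(l < D) l).
  by rewrite NpW det_mulmx det_affine_mx.
have vn0 n : v ^+ n != 0 by rewrite expf_neq0// gt_eqF.
have W0 : \det W != 0.
  by apply: contraNneq Np0 => W0; rewrite detW W0 mul0r.
split.
  rewrite detA !mulf_neq0// -normr_gt0; apply: lt_le_trans t0 _.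
  by case/andP: dTX.
have -> : \det (interp_mx (fun i => (nd i)%:R) y) =
   \det Np * \det (Tm + X) / v ^+ (e.+1 ^ 2)%N.
  rewrite detA detW sum_ord_square !exprD.
  by field; rewrite vn0.
rewrite normrM normfV (ger0_norm (exprn_ge0 _ (ltW v0))); apply: ler_wpM2r.
  by rewrite invr_ge0 exprn_ge0// ltW.
rewrite normrM; apply: ler_wpM2l => //.
by case/andP: dTX.
Qed.

End ClusterDeterminant.

(** * Nodes whose values avoid fractions of moderate height; quadratic irrationals *)

Section NoCluster.
Variable R : realType.

Definition grid (x : R) (b n : nat) : R :=
  ((Num.floor (x * b%:R ^+ 4))%:~R + n%:R) / b%:R ^+ 4.

Lemma no_cluster (f : R -> R) x c M rho e (nd : 'I_(e.+1 + e.+1) -> nat) (k : nat) :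
  (0 < e)%N -> taylor f x c M rho -> \det (toeplitz c e) != 0 -> injective nd ->
  (forall i, (nd i < k)%N) ->
  \forall b \near \oo, forall (r : 'I_(e.+1 + e.+1) -> int) (s : 'I_(e.+1 + e.+1) -> nat),
    (forall i, (b ^ e <= s i < b ^ e.+1)%N) ->
    ~ (forall i, `|f (grid x b (nd i)) - (r i)%:~R / (s i)%:R| < 2 / (s i)%:R ^+ 14).
Proof.
move=> e0 T tz injn ndk; have r0 := T.1.
pose m := (2 * e.+1 ^ 2)%N.
(* [Ea] weighs the errors [b ^ (14 e)] against [v ^ (2e + 1)]; the surplus [6e - 4] is positive
   since [e >= 1]. By [Ec] the denominators multiply to at most [b ^ m], and by [Ed] the determinant
   gains [b ^ (2m)]. *)
have Ea : (14 * e = 4 * (e.+1 + e.+1).-1 + (6 * e - 4))%N by clear -e0; lia.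
have Eb : (0 < 6 * e - 4)%N by clear -e0; lia.
have Ec : (e.+1 * (e.+1 + e.+1) = m)%N by rewrite /m -mulnn; ring.
have Ed : (4 * e.+1 ^ 2 = m + m)%N by rewrite /m; ring.
have Ee : (0 < m)%N by rewrite /m muln_gt0 expn_gt0.
have [eps [K [eps0 H]]] := cluster_det T tz injn ndk.
near=> b => r s sb app.
have b1 : 1 <= b%:R :> R by near: b; exact: nbhs_infty_ger.
have b0 : 0 < b%:R :> R by apply: lt_le_trans b1.
have bk : k%:R <= b%:R :> R by near: b; exact: nbhs_infty_ger.
have bkr : k%:R / rho <= b%:R by near: b; exact: nbhs_infty_ger.
have be : 3 / eps <= b%:R by near: b; exact: nbhs_infty_ger.
have bK : K + 1 <= b%:R by near: b; exact: nbhs_infty_ger.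
pose v := b%:R ^+ 4 : R.
have v0 : 0 < v by rewrite exprn_gt0.
have bv : b%:R <= v by rewrite -[leLHS]expr1; apply: ler_weXn2l.
pose th := x * v - (Num.floor (x * v))%:~R.
have th01 : 0 <= th <= 1.
  have := floor_itv (x * v); rewrite intrD => /andP[h1 h2].
  by rewrite /th; apply/andP; split; lra.
have gridE n : grid x b n = x + (n%:R - th) / v.
  by rewrite /grid /th -/v; field; rewrite gt_eqF.
have s0 i : 0 < (s i)%:R :> R.
  rewrite ltr0n (leq_trans _ (proj1 (andP (sb i))))// expn_gt0 -(ltr0n R) b0//.
pose y i := (r i)%:~R / (s i)%:R : R.
pose eta := 2 / b%:R ^+ (14 * e) : R.
have [det0 detK] : \det (interp_mx (fun i => (nd i)%:R) y) != 0 /\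
    `|\det (interp_mx (fun i => (nd i)%:R) y)| <= K / v ^+ (e.+1 ^ 2)%N.
  apply: (H v th eta y) => //.
  - exact: le_trans bv.
  - exact: le_trans bv.
  - rewrite mulrC -ler_pdivrMr//; exact: le_trans bv.
  - move=> i; rewrite -gridE distrC; apply: le_trans (ltW (app i)) _.
    rewrite ler_wpM2l// lef_pV2 ?posrE ?exprn_gt0// mulnC exprM.
    apply: lerXn2r; rewrite ?nnegrE ?exprn_ge0 ?(ltW b0) ?(ltW (s0 i))//.
    by rewrite -natrX ler_nat; case/andP: (sb i).
  - have -> : v ^+ (e.+1 + e.+1).-1 * (eta + v ^- (e.+1 + e.+1)) =
      2 / b%:R ^+ (6 * e - 4) + v^-1.
      rewrite mulrDr; congr (_ + _).
        rewrite /eta Ea exprD /v -exprM.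
        by rewrite invfM mulrCA [X in _ * X]mulrA mulfV ?mul1r// expf_neq0// gt_eqF.
      rewrite addSn /= exprS invfM mulrCA mulfV ?mulr1//.
      by rewrite expf_neq0// gt_eqF.
    apply: (@le_trans _ _ (3 / b%:R)).
      have h1 : (b%:R ^+ (6 * e - 4))^-1 <= b%:R^-1 :> R.
        rewrite lef_pV2 ?posrE ?exprn_gt0// -[leLHS]expr1.
        by apply: ler_weXn2l.
      have h2 : v^-1 <= b%:R^-1 by rewrite lef_pV2 ?posrE.
      lra.
    by rewrite ler_pdivrMr// mulrC -ler_pdivrMr.
pose A := interp_mx (fun i => (nd i)%:R) y.
pose Z := diag_mx (\row_i (s i)%:R) *m A.
have detZ : \det Z = (\prod_i (s i)%:R) * \det A.
  by rewrite det_mulmx det_diag; congr (_ * _); apply: eq_bigr => i _; rewrite mxE.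
have Z1 : 1 <= `|\det Z|.
  apply: det_int_ge1.
    move=> i j; rewrite /Z mul_diag_mx !mxE; case: split_ordP => l _; rewrite mxE.
      exists ((s i)%:Z * (nd i)%:Z ^+ l).
      by rewrite intrM rmorphXn /= -!pmulrn.
    exists (r i * (nd i)%:Z ^+ l).
    rewrite intrM rmorphXn /= -!pmulrn /y.
    by field; rewrite gt_eqF.
  by rewrite detZ mulf_neq0//; apply/prodf_neq0 => i _; rewrite gt_eqF.
have prs : \prod_i (s i)%:R <= b%:R ^+ m :> R.
  apply: (@le_trans _ _ (\prod_(i < e.+1 + e.+1) b%:R ^+ e.+1)).
    apply: ler_prod => i _; rewrite ltW ?s0//= -natrX ler_nat ltnW//.
    by case/andP: (sb i).
  by rewrite prodr_const card_ord -exprM Ec.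
have : 1 <= b%:R ^+ m * (K / v ^+ (e.+1 ^ 2)%N).
  apply: le_trans Z1 _; rewrite detZ normrM ger0_norm; last first.
    by apply: prodr_ge0.
  by apply: ler_pM => //; apply: prodr_ge0.
have -> : v ^+ (e.+1 ^ 2)%N = b%:R ^+ m * b%:R ^+ m.
  by rewrite /v -exprM -exprD Ed.
have bm0 : 0 < b%:R ^+ m :> R by rewrite exprn_gt0.
have -> : b%:R ^+ m * (K / (b%:R ^+ m * b%:R ^+ m)) = K / b%:R ^+ m.
  by field; rewrite gt_eqF.
rewrite ler_pdivlMr// mul1r => Kb.
have : b%:R <= b%:R ^+ m :> R.
  by rewrite -[leLHS]expr1; apply: ler_weXn2l.
lra.
Unshelve. all: by end_near. Qed.

(** With [k] nodes one of the [A] exponent classes holds at least [2A + 2] of them, enough for any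
    [e < A]. The offset 2 keeps the nodes at distance at least [b ^- 4] to the right of [x], see
    [grid_dist]. *)
Lemma exists_good_node (f : R -> R) x c M rho A :
  (0 < A)%N -> taylor f x c M rho -> (forall e, (e < A)%N -> \det (toeplitz c e) != 0) ->
  let k := (A * (A + A).+2)%N in
  \forall b \near \oo, forall (r : 'I_k -> int) (s : 'I_k -> nat),
    (forall i, (b <= s i < b ^ A)%N) ->
    exists i : 'I_k, 2 / (s i)%:R ^+ 14 <= `|f (grid x b i.+2) - (r i)%:~R / (s i)%:R|.
Proof.
move=> A0 T tz k.
(* For fixed [A] there are finitely many exponents and choices of nodes, so one threshold for [b]
   serves them all. *)
have Hall : \forall b \near \oo, forall (e : 'I_A) (sg : {ffun 'I_(e.+1 + e.+1) -> 'I_k}),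
    (0 < e)%N -> injective sg ->
    forall (r : 'I_(e.+1 + e.+1) -> int) (s : 'I_(e.+1 + e.+1) -> nat),
    (forall i, (b ^ e <= s i < b ^ e.+1)%N) ->
    ~ (forall i, `|f (grid x b (sg i).+2) - (r i)%:~R / (s i)%:R| < 2 / (s i)%:R ^+ 14).
  apply: filter_forall => e; apply: filter_forall => sg.
  have [e0|] := pselect (0 < e)%N; last by move=> ne; apply: nearW => b /ne.
  have [isg|] := pselect (injective sg); last by move=> ni; apply: nearW => b _ /ni.
  have inj2 : injective (fun i => (sg i).+2).
    by move=> i j [] /val_inj /isg.
  have lt2 i : ((sg i).+2 < k.+2)%N by rewrite !ltnS.
  apply: filterS (no_cluster e0 T (tz _ (ltn_ord e)) inj2 lt2) => b Hb _ _ r s.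
  exact: Hb.
near=> b => r s sb.
have b1 : (1 < b)%N by near: b; exact: nbhs_infty_gt.
have Hb : forall (e : 'I_A) (sg : {ffun 'I_(e.+1 + e.+1) -> 'I_k}),
    (0 < e)%N -> injective sg ->
    forall (r : 'I_(e.+1 + e.+1) -> int) (s : 'I_(e.+1 + e.+1) -> nat),
    (forall i, (b ^ e <= s i < b ^ e.+1)%N) ->
    ~ (forall i, `|f (grid x b (sg i).+2) - (r i)%:~R / (s i)%:R| < 2 / (s i)%:R ^+ 14).
  by near: b; exact: Hall.
apply: contrapT => nex.
have app (i : 'I_k) : `|f (grid x b i.+2) - (r i)%:~R / (s i)%:R| < 2 / (s i)%:R ^+ 14.
  by rewrite ltNge; apply/negP => h; apply: nex; exists i.
have sp i : (0 < s i)%N.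
  by have /andP[h _] := sb i; rewrite (leq_trans _ h)// ltnW.
have tlA i : (trunc_log b (s i) < A)%N.
  have /andP[_ h] := sb i; have /andP[h1 _] := trunc_log_bounds b1 (sp i).
  by rewrite -(ltn_exp2l _ _ b1) (leq_ltn_trans h1).
(* Class 0 is empty because [s i >= b]; [no_cluster] needs [e >= 1]. *)
have tl0 i : (0 < trunc_log b (s i))%N.
  have /andP[h _] := sb i; have /andP[_ h1] := trunc_log_bounds b1 (sp i).
  by rewrite -ltnS -(ltn_exp2l _ _ b1) expn1 (leq_ltn_trans h).
pose cl i : 'I_A := Ordinal (tlA i).
have [e he] : exists e : 'I_A, (e.+1 + e.+1 <= #|[pred i | cl i == e]|)%N.
  apply: contrapT => nE.
  have small (e : 'I_A) : (#|[pred i | cl i == e]| <= (A + A).+1)%N.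
    have : ~~ (e.+1 + e.+1 <= #|[pred i | cl i == e]|)%N.
      by apply/negP => h; apply: nE; exists e.
    by have := ltn_ord e; clear; lia.
  have : (k <= A * (A + A).+1)%N.
    rewrite -{1}(card_ord k) -sum1_card (partition_big cl predT)//=.
    rewrite -[X in (_ <= X * _)%N](card_ord A) -sum_nat_const; apply: leq_sum => e _.
    apply: leq_trans (small e); rewrite -sum1_card; apply: eq_leq.
    by apply: eq_bigl => i; rewrite inE.
  by rewrite /k leq_pmul2l// ltnn.
pose sg := [ffun i : 'I_(e.+1 + e.+1) => enum_val (widen_ord he i)].
have sgin i : cl (sg i) = e.
  have : sg i \in [pred i | cl i == e] by rewrite ffunE enum_valP.
  by rewrite inE => /eqP.
have isg : injective sg.
  by move=> i j; rewrite !ffunE => /enum_val_inj /(congr1 val) /= /val_inj.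
have ee i : trunc_log b (s (sg i)) = e by exact: (congr1 (@nat_of_ord A) (sgin i)).
have e0 : (0 < e)%N by have := tl0 (sg ord0); rewrite ee.
apply: (Hb e sg e0 isg (fun i => r (sg i)) (fun i => s (sg i))) => i.
  by have := trunc_log_bounds b1 (sp (sg i)); rewrite ee.
exact: app.
Unshelve. all: by end_near. Qed.

(** The 2-adic valuations have different parities. *)
Lemma sqr_neq_double_sqr (s B : nat) : (0 < s)%N -> (B ^ 2 != 2 * s ^ 2)%N.
Proof.
move=> s0; apply/eqP => E; have B0 : (0 < B)%N.
  by rewrite -(ltn_exp2r 0 B (e := 2))// exp0n// E muln_gt0 expn_gt0 s0.
have := congr1 (logn 2) E; rewrite lognM ?expn_gt0 ?s0// !lognX.
by rewrite (_ : logn 2 2 = 1%N)//; move: (logn 2 B) (logn 2 s); clear; lia.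
Qed.

Lemma sqrt2_le : Num.sqrt 2 <= 3 / 2 :> R.
Proof.
have h : 0 <= 3 / 2 :> R by lra.
rewrite -[leRHS](ger0_norm h) -sqrtr_sqr; apply: ler_wsqrtr.
by rewrite expr2; lra.
Qed.

(** With [B = r m - k s] the difference is [(s sqrt 2 - B) / (m s)], and the norm [2 s^2 - B^2] is a
    nonzero integer. As [B] absorbs [k], the bound is linear in [1 / m] and uniform in [k]. *)
Lemma quadratic_badly_approx (k r : int) (m s : nat) : (0 < m)%N -> (0 < s)%N ->
  1 / (5 * m%:R * s%:R ^+ 2) <= `|(k%:~R + Num.sqrt 2) / m%:R - r%:~R / s%:R| :> R.
Proof.
move=> m0 s0; pose B : int := r * m%:Z - k * s%:Z.
have m0' : 0 < m%:R :> R by rewrite ltr0n.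
have s0' : 1 <= s%:R :> R by rewrite ler1n.
have sp : 0 < s%:R :> R by apply: lt_le_trans s0'.
set q := Num.sqrt 2; have q0 : 0 <= q by rewrite sqrtr_ge0.
have q2 : q ^+ 2 = 2 by rewrite sqr_sqrtr.
have q32 : q <= 3 / 2 by exact: sqrt2_le.
pose t : R := s%:R * q - B%:~R.
have -> : (k%:~R + q) / m%:R - r%:~R / s%:R = t / (m%:R * s%:R).
  rewrite /t /B intrB !intrM -!pmulrn; field.
  by rewrite !gt_eqF.
rewrite normrM normfV [`|m%:R * _|]ger0_norm ?mulr_ge0// ler_pdivlMr ?mulr_gt0//.
have -> : 1 / (5 * m%:R * s%:R ^+ 2) * (m%:R * s%:R) = 1 / (5 * s%:R) :> R.
  by field; rewrite !gt_eqF.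
have prod1 : 1 <= `|t| * `|s%:R * q + B%:~R|.
  rewrite -normrM /t -subr_sqr exprMn q2.
  have -> : s%:R ^+ 2 * 2 - B%:~R ^+ 2 = (s%:Z ^+ 2 * 2 - B ^+ 2)%:~R :> R.
    by rewrite !(rmorphB, rmorphM, rmorphXn) /=.
  rewrite -intr_norm (_ : 1 = 1%:~R)// ler_int -gtz0_ge1 normr_gt0 subr_eq0.
  apply/eqP => E; have /eqP := @sqr_neq_double_sqr s `|B|%N s0; apply.
  have := congr1 absz E; rewrite abszM !abszX /= => <-.
  by rewrite mulnC.
rewrite ler_pdivrMr ?mulr_gt0//.
have [t1|t1] := leP 1 `|t|; first by nra.
have : `|s%:R * q + B%:~R| <= 5 * s%:R.
  have -> : s%:R * q + B%:~R = 2 * (s%:R * q) - t by rewrite /t; ring.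
  apply: le_trans (ler_normB _ _) _.
  rewrite ger0_norm ?mulr_ge0//; nra.
move: prod1; have := normr_ge0 t; move: `|t| (`|s%:R * q + _|) => a c; nra.
Qed.

End NoCluster.

(** * The invariant of the construction and one stage of it *)

Section Stage.
Variable R : realType.
Implicit Types (U : set R) (f : R -> R).

Lemma germ_continuous f x : germ f x -> {for x, continuous f}.
Proof.
move=> [c [M [rho T]]]; have M0 := taylor_ge0 T; have [r0 H] := T.
apply/cvgrPdist_le => e e0; near=> y.
have yr : `|y - x| <= rho.
  by rewrite distrC; near: y; exact: cvgr_dist_le.
have yd : `|y - x| <= e * rho / (M + 1).
  rewrite distrC; near: y; apply: cvgr_dist_le => //.
  by rewrite divr_gt0// ?mulr_gt0//; lra.
have := H 1%N (y - x) yr; rewrite subrKC big_ord1 expr0 mulr1 expr1 -(taylor_center T).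
rewrite distrC => /le_trans; apply.
move: yd; rewrite ler_pdivlMr; last by lra.
move=> yd; rewrite mulrA ler_pdivrMr//; have := normr_ge0 (y - x); nra.
Unshelve. all: by end_near. Qed.

(** The values of [f] at the endpoints are at least [2 / m] apart, so some [(k + sqrt 2) / m] lies
    strictly between them; apply the intermediate value theorem. *)
Lemma pick_quadratic U f x w l (m : nat) : (forall x, U x -> germ f x) -> 0 < w -> (0 < m)%N ->
  (forall y, x <= y <= x + w -> U y) -> l * w <= `|f x - f (x + w)| ->
  2 / m%:R <= l * w ->
  exists xi (k : int), x < xi < x + w /\ f xi = (k%:~R + Num.sqrt 2) / m%:R.
Proof.
move=> gf w0 m0 HU lw mw.
have m0' : 0 < m%:R :> R by rewrite ltr0n.
set a := f x; set b := f (x + w).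
pose lo := Num.min a b; pose hi := Num.max a b.
have hilo : hi - lo = `|a - b|.
  rewrite /hi /lo; have [ab|ab] := leP a b.
    by rewrite distrC ger0_norm ?subr_ge0.
  by rewrite ger0_norm ?subr_ge0 ?ltW.
have gap : 2 / m%:R <= hi - lo by rewrite hilo; apply: le_trans lw.
pose k := Num.floor (lo * m%:R - Num.sqrt 2) + 1.
pose y : R := (k%:~R + Num.sqrt 2) / m%:R.
have := floor_itv (lo * m%:R - Num.sqrt 2); rewrite -/k => /andP[k1 k2].
have ylo : lo < y by rewrite /y ltr_pdivlMr//; lra.
have yhi : y < hi.
  apply: (@lt_le_trans _ _ (lo + 2 / m%:R)); last by lra.
  rewrite /y ltr_pdivrMr// mulrDl divfK ?gt_eqF//.
  by rewrite /k intrD; lra.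
have cf : {within `[x, x + w], continuous f}.
  apply: continuous_in_subspaceT => z; rewrite inE /= in_itv /= => zI.
  by apply: germ_continuous; apply: gf; exact: HU.
have xw : x <= x + w by rewrite lerDl ltW.
have [|xi] := IVT xw cf (v := y).
  by rewrite -/a -/b -/lo -/hi !ltW.
rewrite in_itv /= => /andP[x1 x2] fxi.
exists xi, k; split => //.
have lya : y != a.
  apply/eqP => ya; move: ylo yhi; rewrite /lo /hi -ya; case: (leP y b); lra.
have lyb : y != b.
  apply/eqP => yb; move: ylo yhi; rewrite /lo /hi -yb; case: (leP a y); lra.
rewrite !lt_neqAle x1 x2 !andbT; apply/andP; split.
  by apply/eqP => E; move: lya; rewrite -fxi -E eqxx.
by apply/eqP => E; move: lyb; rewrite -fxi E eqxx.
Qed.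

(** The determinants make the next stage possible; the third condition covers all [s], with a [kap]
    depending on the point; the last, with [S0] common to all stages, is the one that passes to the
    limit. *)
Definition stage_point U f (S0 A : nat) (tau xi : R) := [/\ U xi,
  (exists c M rho, taylor f xi c M rho /\
     forall e, (e < A)%N -> \det (toeplitz c e) != 0),
  (exists2 kap, 0 < kap & forall (r : int) (s : nat), (0 < s)%N ->
     kap / s%:R ^+ 2 <= `|f xi - r%:~R / s%:R|) &
  forall (r : int) (s : nat), (0 < s)%N -> (S0 <= s)%N ->
     tau / s%:R ^+ 20 <= `|f xi - r%:~R / s%:R|].

(** So the determinant condition at [e = 0] is the hypothesis of [taylor_bilipschitz]. *)
Lemma toeplitz0 c : \det (toeplitz c 0) = c 1%N :> R.
Proof. by rewrite det_mx11 mxE. Qed.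

Lemma stage_start U f x0 A : open U -> is_interval U ->
  (forall x, U x -> germ f x) -> ~ rational_on U f -> U x0 ->
  exists S0 xi, stage_point U f S0 A 2 xi.
Proof.
move=> oU iU gf nrat Ux0.
(* A first move makes the derivative nonzero, hence [f] bilipschitz near [x1]; the second, to the
   right of [x1], secures all [A] determinants. *)
have [r0 r00 H0] := toeplitz_nonzero 1 oU iU gf nrat Ux0.
have [|Ux1 [c [M [rho [T tz]]]]] := H0 (r0 / 2).
  by rewrite gtr0_norm ?divr_gt0//=; lra.
set x1 := x0 + r0 / 2 in Ux1 T.
have c1 : c 1%N != 0 by rewrite -toeplitz0 tz.
have [r [l [L [rp lp _ HL]]]] := taylor_bilipschitz T c1.
have [r1 r10 H1] := toeplitz_nonzero A oU iU gf nrat Ux1.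
pose w := Num.min r r1 / 3.
have mp : 0 < Num.min r r1 by rewrite lt_min rp.
have wp : 0 < w by rewrite divr_gt0.
have wmin : 2 * w < Num.min r r1 by rewrite /w; lra.
have [wr wr1] : 2 * w < r /\ 2 * w < r1 by move: wmin; rewrite lt_min => /andP.
have inU y : x1 + w <= y <= x1 + w + w -> U y /\ 0 < `|y - x1| < r1.
  move=> /andP[y1 y2].
  have h : 0 < `|y - x1| < r1 by rewrite ger0_norm; [apply/andP; split; lra|lra].
  by split => //; have [] := H1 (y - x1) h; rewrite subrKC.
pose m := (Num.truncn (2 / (l * w))).+1.
have [xi [k [xiI fxi]]] : exists xi (k : int), x1 + w < xi < x1 + w + w /\
    f xi = (k%:~R + Num.sqrt 2) / m%:R.
  apply: (@pick_quadratic U f (x1 + w) w l m) => //.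
  - by move=> y /inU[].
  - have d1 : `|x1 + w - x1| <= r by rewrite ger0_norm; lra.
    have d2 : `|x1 + w + w - x1| <= r by rewrite ger0_norm; lra.
    have /andP[h _] := HL _ _ d1 d2.
    have -> // : l * w = l * `|x1 + w - (x1 + w + w)|.
    by congr (_ * _); rewrite distrC ger0_norm; [ring|lra].
  - rewrite ler_pdivrMr ?ltr0n// mulrC -ler_pdivrMr ?mulr_gt0//.
    by rewrite ltW// truncnS_gt.
have xiI' : x1 + w <= xi <= x1 + w + w by case/andP: xiI => ? ?; rewrite !ltW.
have [Uxi xir] := inU _ xiI'.
have m0 : 0 < m%:R :> R by rewrite ltr0n.
(* Once [10 * m <= s], the quadratic bound [1 / (5 * m * s ^+ 2)] is at least [2 / s ^+ 20]. *)
pose S0 := (Num.truncn (10 * m%:R : R)).+1.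
exists S0, xi; split => //.
- by have [_] := H1 _ xir; rewrite subrKC.
- exists (1 / (5 * m%:R)); first by rewrite divr_gt0 ?mulr_gt0.
  move=> p s s0; rewrite fxi; apply: le_trans (quadratic_badly_approx R _ _ _ s0) => //.
  by rewrite !mul1r -invfM.
- move=> p s s0 Ss; rewrite fxi; apply: le_trans (quadratic_badly_approx R _ _ _ s0) => //.
  have sp : 1 <= s%:R :> R by rewrite ler1n.
  have sR : 0 < s%:R :> R by rewrite ltr0n.
  have Sm : 10 * m%:R <= s%:R :> R.
    apply: (@le_trans _ _ S0%:R); last by rewrite ler_nat.
    by rewrite ltW// truncnS_gt.
  rewrite ler_pdivrMr ?exprn_gt0// mulrAC ler_pdivlMr ?mulr_gt0 ?exprn_gt0// mul1r.
  have -> : s%:R ^+ 20 = s%:R ^+ 2 * s%:R ^+ 18 :> R by rewrite -exprD.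
  have : s%:R <= s%:R ^+ 18 :> R by rewrite -[leLHS]expr1; apply: ler_weXn2l.
  have : 0 < s%:R ^+ 2 :> R by rewrite exprn_gt0.
  move: (s%:R ^+ 2) (s%:R ^+ 18) => a b; nra.
Qed.

Lemma grid_dist (xi : R) (b n : nat) : (0 < b)%N ->
  (n%:R - 1) / b%:R ^+ 4 <= grid xi b n - xi <= n%:R / b%:R ^+ 4.
Proof.
move=> b0; have v0 : 0 < b%:R ^+ 4 :> R by rewrite exprn_gt0// ltr0n.
have := floor_itv (xi * b%:R ^+ 4); rewrite intrD => /andP[h1 h2].
rewrite /grid; set u := (Num.floor _)%:~R in h1 h2 *.
have -> : (u + n%:R) / b%:R ^+ 4 - xi = (u + n%:R - xi * b%:R ^+ 4) / b%:R ^+ 4.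
  by field; rewrite gt_eqF// ltr0n.
by rewrite !ler_pM2r ?invr_gt0//; apply/andP; split; lra.
Qed.

(** [n] is at once the order of the approximation by [p / v] and the number of nonzero determinants
    at [xi], so that the chosen node takes care of all denominators from [b] to [b ^ n]. *)
Lemma stage_step U f S0 n A' tau tau' xi eps : open U -> is_interval U ->
  (forall x, U x -> germ f x) -> ~ rational_on U f -> (0 < n)%N -> 0 < eps ->
  0 < tau' -> tau' < tau -> tau' <= 2 -> stage_point U f S0 n tau xi ->
  exists xi' (p : int) (v : nat), [/\ stage_point U f S0 A' tau' xi', `|xi' - xi| < eps,
    (2 <= v)%N & 0 < `|xi' - p%:~R / v%:R| < v%:R ^- n].
Proof.
move=> oU iU gf nrat n0 eps0 tau'0 tt tau'2 [Uxi [c [M [rho [T tz]]]] [kap kap0 Hkap] Htau].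
have c1 : c 1%N != 0 by rewrite -toeplitz0 tz.
have [r [l [L [rp lp Lp HL]]]] := taylor_bilipschitz T c1.
have [r1 r10 H1] := toeplitz_nonzero A' oU iU gf nrat Uxi.
pose k := (n * (n + n).+2)%N.
(* For [s >= Sy], [2 / s ^+ 20] is at most half of [kap / s ^+ 2]. *)
pose Sy := (Num.truncn (4 / kap)).+1.
pose rr := Num.min (Num.min r r1) eps.
have rr0 : 0 < rr by rewrite !lt_min rp r10.
have Hnode := exists_good_node n0 T tz.
near \oo => b.
have b2 : (1 < b)%N by near: b; exact: nbhs_infty_gt.
have b1 : 1 <= b%:R :> R by rewrite ler1n ltnW.
have b0 : 0 < b%:R :> R by apply: lt_le_trans b1.
have bL : L <= b%:R by near: b; exact: nbhs_infty_ger.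
have brr : (k%:R + 3) / rr + 1 <= b%:R by near: b; exact: nbhs_infty_ger.
have bl : 20 / l + 10 <= b%:R by near: b; exact: nbhs_infty_ger.
have bt : L * (k%:R + 3) * Sy%:R ^+ 20 / (tau - tau') <= b%:R by near: b; exact: nbhs_infty_ger.
have bkap : 2 * L * (k%:R + 3) / kap <= b%:R by near: b; exact: nbhs_infty_ger.
have Hb : forall (r : 'I_k -> int) (s : 'I_k -> nat),
    (forall i, (b <= s i < b ^ n)%N) ->
    exists i : 'I_k, 2 / (s i)%:R ^+ 14 <= `|f (grid xi b i.+2) - (r i)%:~R / (s i)%:R|.
  by near: b; exact: Hnode.
(* If every node failed at some fraction, choosing one such fraction per node would contradict
   [Hb]. *)
have [i Hi] : exists i : 'I_k, forall (r : int) (s : nat), (b <= s < b ^ n)%N ->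
    2 / s%:R ^+ 14 <= `|f (grid xi b i.+2) - r%:~R / s%:R|.
  apply: contrapT => /forallNP nE.
  have /choice[rs Hrs] : forall i : 'I_k, exists rs : int * nat, (b <= rs.2 < b ^ n)%N /\
     `|f (grid xi b i.+2) - rs.1%:~R / rs.2%:R| < 2 / rs.2%:R ^+ 14.
    move=> i; apply: contrapT => /forallNP nrs; apply: (nE i) => p s sb.
    by rewrite leNgt; apply/negP => h; apply: (nrs (p, s)).
  have [i] := Hb (fun i => (rs i).1) (fun i => (rs i).2) (fun i => (Hrs i).1).
  by rewrite leNgt (Hrs i).2.
pose v := (b ^ 4)%N.
have vE : v%:R = b%:R ^+ 4 :> R by rewrite /v natrX.
have v0 : 0 < b%:R ^+ 4 :> R by rewrite exprn_gt0.
(* The interval searched for [xi'] has length [w = P^-1]: since [L <= b], moving from [x] to [xi']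
   changes [f] by at most [1 / s ^+ 14] for every [s < b ^ n], half of what the node guarantees. *)
pose P := b%:R ^+ (14 * n + 1) : R.
have P0 : 0 < P by rewrite exprn_gt0.
pose w := P^-1; have w0 : 0 < w by rewrite invr_gt0.
pose x := grid xi b i.+2.
have bv : b%:R <= b%:R ^+ 4 :> R by rewrite -[leLHS]expr1; apply: ler_weXn2l.
have wv : w <= (b%:R ^+ 4)^-1.
  by rewrite lef_pV2 ?posrE//; apply: ler_weXn2l => //; clear -n0; lia.
have ik : i.+2%:R <= k%:R + 1 :> R by rewrite natr1 ler_nat ltnS.
have i2 : 2 <= i.+2%:R :> R by rewrite ler_nat.
have xgt : (b%:R ^+ 4)^-1 <= x - xi <= (k%:R + 1) / b%:R ^+ 4.
  have /andP[h1 h2] := grid_dist xi i.+2 (ltnW b2).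
  apply/andP; split; [apply: le_trans h1|apply: le_trans h2 _].
    rewrite -[leLHS]mul1r ler_pM2r ?invr_gt0//.
    by move: i2; clear; lra.
  by rewrite ler_pM2r ?invr_gt0.
pose dd := (k%:R + 3) / b%:R ^+ 4 : R.
have ddb : dd <= (k%:R + 3) / b%:R.
  by apply: ler_wpM2l; [rewrite addr_ge0|rewrite lef_pV2 ?posrE].
have ddrr : dd < rr.
  apply: le_lt_trans ddb _; rewrite ltr_pdivrMr// mulrC -ltr_pdivrMr//.
  by move: brr; clear; lra.
have near_xi y : x <= y <= x + w -> 0 < `|y - xi| <= dd.
  move=> /andP[y1 y2]; case/andP: xgt => xg1 xg2.
  have vi0 : 0 < (b%:R ^+ 4)^-1 :> R by rewrite invr_gt0.
  rewrite /dd; move: wv xg1 xg2 y1 y2 vi0; clear => *.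
  by rewrite ger0_norm; [apply/andP; split; lra|lra].
have rrle : [/\ rr <= r, rr <= r1 & rr <= eps].
  by rewrite /rr; split; rewrite !ge_min lexx ?orbT.
have [rrr rrr1 rreps] := rrle.
have near_r1 y : x <= y <= x + w -> 0 < `|y - xi| < r1.
  move=> /near_xi/andP[-> h] /=; apply: le_lt_trans h _.
  exact: lt_le_trans rrr1.
have near_r y : x <= y <= x + w -> `|y - xi| <= r.
  by move=> /near_xi/andP[_ h]; apply: le_trans h _; apply: ltW; apply: lt_le_trans rrr.
have xI : x <= x <= x + w by rewrite lexx lerDl ltW.
have xwI : x <= x + w <= x + w by rewrite lexx lerDl ltW.
pose m := (Num.truncn (2 / (l * w))).+1.
have m0 : 0 < m%:R :> R by rewrite ltr0n.
have [xi' [kk [xiI fxi]]] : exists xi' (kk : int), x < xi' < x + w /\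
    f xi' = (kk%:~R + Num.sqrt 2) / m%:R.
  apply: (@pick_quadratic U f x w l m) => //.
  - by move=> y /near_r1 h; have [] := H1 _ h; rewrite subrKC.
  - have /andP[h _] := HL x (x + w) (near_r _ xI) (near_r _ xwI).
    have -> // : l * w = l * `|x - (x + w)|.
    by congr (_ * _); rewrite distrC addrAC subrr add0r gtr0_norm.
  - rewrite ler_pdivrMr// mulrC -ler_pdivrMr ?mulr_gt0//.
    by rewrite ltW// truncnS_gt.
have xiI' : x <= xi' <= x + w by case/andP: xiI => ? ?; rewrite !ltW.
have xi'dd : `|xi' - xi| <= dd by case/andP: (near_xi _ xiI').
have mP : 10 * m%:R <= b%:R ^+ (14 * n + 2) :> R.
  have : m%:R <= 2 / l * P + 1 :> R.
    rewrite /m -[leLHS]natr1 lerD2r.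
    have -> : 2 / l * P = 2 / (l * w) by rewrite /w; field; rewrite !gt_eqF.
    have lw0 : 0 <= 2 / (l * w) by rewrite divr_ge0// mulr_ge0// ltW.
    by have /andP[] := truncn_itv lw0.
  have -> : b%:R ^+ (14 * n + 2) = b%:R * P :> R by rewrite /P -exprS addnS.
  have P1 : 1 <= P by rewrite exprn_ege1.
  have : (20 / l + 10) * P <= b%:R * P by rewrite ler_pM2r.
  rewrite mulrDl; have -> : 20 / l * P = 10 * (2 / l * P) by ring.
  by move: P1; clear; lra.
exists xi', (Num.floor (xi * b%:R ^+ 4) + i.+2%:Z), v.
have gx : (Num.floor (xi * b%:R ^+ 4) + i.+2%:Z)%:~R / v%:R = x.
  by rewrite intrD vE /x /grid -pmulrn.
split.
- split.
  + by have [] := H1 _ (near_r1 _ xiI'); rewrite subrKC.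
  + by have [_] := H1 _ (near_r1 _ xiI'); rewrite subrKC.
  + exists (1 / (5 * m%:R)); first by rewrite divr_gt0 ?mulr_gt0.
    move=> p s s0; rewrite fxi; apply: le_trans (quadratic_badly_approx R _ _ _ s0) => //.
    by rewrite !mul1r -invfM.
  + move=> p s s0 Ss.
    have s1 : 1 <= s%:R :> R by rewrite ler1n.
    have sR : 0 < s%:R :> R by rewrite ltr0n.
    have s20 : 0 < s%:R ^+ 20 :> R by rewrite exprn_gt0.
    have fd : `|f xi' - f xi| <= L * dd.
      have h0 : `|xi - xi| <= r by rewrite subrr normr0 ltW.
      have /andP[_ h] := HL xi' xi (near_r _ xiI') h0.
      by apply: le_trans h _; rewrite ler_pM2l.
    have tri (a y z : R) : `|a - z| - `|y - a| <= `|y - z|.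
      have := ler_normD (a - y) (y - z); rewrite addrA subrK (distrC a y).
      by rewrite lerBlDl.
    (* Bounded denominators: the old invariant loses at most [tau - tau'], since [b] is large in
       terms of [Sy]. *)
    have [sSy|Sys] := ltnP s Sy.
      apply: le_trans (tri (f xi) _ _).
      have h1 := Htau p s s0 Ss.
      suff : L * dd <= (tau - tau') / s%:R ^+ 20 by move: h1 fd; clear; lra.
      rewrite ler_pdivlMr//.
      apply: (@le_trans _ _ (L * ((k%:R + 3) / b%:R) * Sy%:R ^+ 20)).
        apply: ler_pM; [by rewrite mulr_ge0 ?divr_ge0 ?addr_ge0// ltW|exact: ltW|by rewrite ler_pM2l|].
        by apply: lerXn2r; rewrite ?nnegrE// ler_nat ltnW.
      move: bt; rewrite ler_pdivrMr ?subr_gt0// => bt.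
      rewrite (_ : _ * _ * _ = L * (k%:R + 3) * Sy%:R ^+ 20 / b%:R); last by ring.
      by rewrite ler_pdivrMr// [leRHS]mulrC.
    have [sb|bs] := ltnP s b.
      apply: le_trans (tri (f xi) _ _).
      have h1 := Hkap p s s0.
      have h2 : L * dd <= kap / 2 / s%:R ^+ 2.
        apply: (@le_trans _ _ (kap / 2 / b%:R ^+ 2)); last first.
          apply: ler_wpM2l; first by rewrite divr_ge0// ltW.
          rewrite lef_pV2 ?posrE ?exprn_gt0//.
          by apply: lerXn2r; rewrite ?nnegrE// ler_nat ltnW.
        rewrite ler_pdivlMr ?exprn_gt0// /dd.
        rewrite (_ : _ * _ * _ = L * (k%:R + 3) / b%:R ^+ 2); last first.
          by field; rewrite gt_eqF.
        rewrite ler_pdivrMr ?exprn_gt0//.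
        move: bkap; rewrite ler_pdivrMr// => bkap.
        have bb : b%:R <= b%:R ^+ 2 :> R by rewrite -[leLHS]expr1; apply: ler_weXn2l.
        have : b%:R * kap <= b%:R ^+ 2 * kap by rewrite ler_pM2r.
        by move: bkap; clear; lra.
      have h3 : 2 / s%:R ^+ 20 <= kap / 2 / s%:R ^+ 2.
        rewrite ler_pdivrMr// mulrAC ler_pdivlMr ?exprn_gt0//.
        have -> : s%:R ^+ 20 = s%:R ^+ 18 * s%:R ^+ 2 :> R by rewrite -exprD.
        rewrite [leRHS]mulrA ler_pM2r ?exprn_gt0//.
        have : 4 / kap <= s%:R.
          apply: (@le_trans _ _ Sy%:R); last by rewrite ler_nat.
          by rewrite ltW// truncnS_gt.
        rewrite ler_pdivrMr// => h4.
        have : s%:R <= s%:R ^+ 18 :> R by rewrite -[leLHS]expr1; apply: ler_weXn2l.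
        move: kap0 h4; clear; move: (s%:R ^+ 18) => u; nra.
      have h4 : tau' / s%:R ^+ 20 <= 2 / s%:R ^+ 20 by rewrite ler_pM2r ?invr_gt0.
      by move: h1 h2 h3 h4 fd; clear; lra.
    have h4 : tau' / s%:R ^+ 20 <= 2 / s%:R ^+ 20 by rewrite ler_pM2r ?invr_gt0.
    apply: le_trans h4 _.
    have [sbn|bns] := ltnP s (b ^ n).
      have h1 : 2 / s%:R ^+ 14 <= `|f x - p%:~R / s%:R| by apply: Hi; rewrite bs.
      apply: le_trans (tri (f x) _ _).
      have s14 : 0 < s%:R ^+ 14 :> R by rewrite exprn_gt0.
      have h2 : `|f xi' - f x| <= 1 / s%:R ^+ 14.
        have /andP[_ h] := HL xi' x (near_r _ xiI') (near_r _ xI).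
        apply: le_trans h _; apply: (@le_trans _ _ (L * w)).
          rewrite ler_pM2l//; case/andP: xiI => ? ?.
          by rewrite gtr0_norm ?subr_gt0// lerBlDl ltW.
        rewrite ler_pdivlMr// /w mulrAC ler_pdivrMr// mul1r.
        rewrite /P exprD expr1 mulrC.
        apply: ler_pM; [exact: ltW|exact: ltW| |exact: bL].
        rewrite mulnC exprM; apply: lerXn2r; rewrite ?nnegrE ?exprn_ge0//.
        by rewrite -natrX ler_nat ltnW.
      have h3 : 2 / s%:R ^+ 20 <= 1 / s%:R ^+ 14 :> R.
        rewrite ler_pdivrMr// mulrAC ler_pdivlMr// mul1r.
        have -> : s%:R ^+ 20 = s%:R ^+ 6 * s%:R ^+ 14 :> R by rewrite -exprD.
        rewrite ler_pM2r//.
        have s2 : 2 <= s%:R :> R by rewrite ler_nat (leq_trans b2).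
        apply: le_trans s2 _; rewrite -[leLHS]expr1; exact: ler_weXn2l.
      by move: h1 h2 h3; clear; lra.
    (* Here [s >= b ^ n], and [14 n + 2 <= 18 n] lets [s ^+ 18] absorb [10 m]. *)
    rewrite fxi; apply: le_trans (quadratic_badly_approx R _ _ _ s0) => //.
    rewrite ler_pdivrMr// mulrAC ler_pdivlMr ?mulr_gt0 ?exprn_gt0// mul1r.
    have -> : s%:R ^+ 20 = s%:R ^+ 18 * s%:R ^+ 2 :> R by rewrite -exprD.
    rewrite [leLHS]mulrA ler_pM2r ?exprn_gt0//.
    have -> : 2 * (5 * m%:R) = 10 * m%:R :> R by ring.
    apply: le_trans mP _; apply: (@le_trans _ _ ((b%:R ^+ n) ^+ 18)).
      rewrite -exprM; apply: ler_weXn2l => //; clear -n0; lia.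
    by apply: lerXn2r; rewrite ?nnegrE ?exprn_ge0// -natrX ler_nat.
- by apply: le_lt_trans xi'dd _; apply: lt_le_trans rreps.
- by rewrite /v (leq_trans b2)// -{1}(expn1 b) leq_exp2l.
rewrite gx; case/andP: xiI => xa xb.
rewrite gtr0_norm ?subr_gt0// xa /= vE -exprM.
apply: (@lt_le_trans _ _ w); first by rewrite ltrBlDl.
by rewrite lef_pV2 ?posrE ?exprn_gt0//; apply: ler_weXn2l => //; clear; lia.
Unshelve. all: by end_near. Qed.

End Stage.

(** * Passage to the limit *)

Section Limit.
Variable R : realType.
Implicit Types (U : set R) (f : R -> R).

(** Strictly decreasing from 2, so each stage can spend some of it, yet always above 1, the constant
    that survives in the limit. *)
Definition slack (n : nat) : R := 1 + n.+1%:R^-1.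

Lemma nested_intervals (u rad : nat -> R) : (forall n, 0 < rad n) ->
  (forall n, `|u n.+1 - u n| + rad n.+1 <= rad n) ->
  exists x, forall n, `|x - u n| <= rad n.
Proof.
move=> r0 H.
have step n : u n - rad n <= u n.+1 - rad n.+1 /\ u n.+1 + rad n.+1 <= u n + rad n.
  have := H n; have h1 := ler_norm (u n.+1 - u n);
  have h3 := ler_norm (u n - u n.+1); rewrite distrC in h3.
  by split; lra.
have lo m n : (m <= n)%N -> u m - rad m <= u n - rad n.
  elim: n => [|n IH]; first by rewrite leqn0 => /eqP ->.
  rewrite leq_eqVlt => /orP[/eqP -> //|mn].
  by apply: le_trans (IH mn) _; have [] := step n.
have hi m n : (m <= n)%N -> u n + rad n <= u m + rad m.
  elim: n => [|n IH]; first by rewrite leqn0 => /eqP ->.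
  rewrite leq_eqVlt => /orP[/eqP -> //|mn].
  by apply: le_trans (IH mn); have [] := step n.
have lohi m n : u m - rad m <= u n + rad n.
  have h : forall n, u n - rad n <= u n + rad n by move=> k; have := r0 k; lra.
  have [mn|nm] := leqP m n; first by apply: le_trans (lo _ _ mn) _.
  by apply: le_trans (hi _ _ (ltnW nm)).
pose A := range (fun n => u n - rad n).
have A0 : A !=set0 by exists (u 0%N - rad 0%N); exists 0%N.
have Aub n : ubound A (u n + rad n) by move=> _ [m _ <-]; exact: lohi.
have Asup : has_sup A by split => //; exists (u 0%N + rad 0%N).
exists (sup A) => n; rewrite ler_distl; apply/andP; split.
  by apply: sup_upper_bound => //; exists n.
exact: ge_sup.
Qed.

Lemma stage_sequence U f x0 : open U -> is_interval U ->
  (forall x, U x -> germ f x) -> ~ rational_on U f -> U x0 ->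
  exists (S0 : nat) (u rad : nat -> R) (p : nat -> int) (v : nat -> nat),
  [/\ forall n, stage_point U f S0 n.+1 (slack n) (u n),
      forall n, 0 < rad n,
      forall n, `|u n.+1 - u n| + rad n.+1 <= rad n,
      forall x, `|x - u 0%N| <= rad 0%N -> U x &
      forall n, [/\ rad n.+1 <= n.+1%:R^-1, (2 <= v n)%N & forall x, `|x - u n.+1| <= rad n.+1 ->
         0 < `|x - (p n)%:~R / (v n)%:R| < (v n)%:R ^- n.+1]].
Proof.
move=> oU iU gf nrat Ux0.
have [S0 [xi0 st0]] := stage_start 1 oU iU gf nrat Ux0.
have slack0 : slack 0 = 2 by rewrite /slack invr1.
rewrite -slack0 in st0.
have [e e0 He] : exists2 e, 0 < e & forall x, `|x - xi0| <= e -> U x.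
  have Uxi : U xi0 by case: st0.
  have /nbhs_ballP[e /= e0 eU] : nbhs xi0 U by apply: open_nbhs_nbhs.
  exists (e / 2); first by rewrite divr_gt0.
  move=> x xe; apply: eU; rewrite /ball /= distrC; apply: le_lt_trans xe _; lra.
pose Pn n (s : R * R) := stage_point U f S0 n.+1 (slack n) s.1 /\ 0 < s.2.
pose Rn n (s s' : R * R) (pv : int * nat) := [/\ `|s'.1 - s.1| + s'.2 <= s.2,
   s'.2 <= n.+1%:R^-1, (2 <= pv.2)%N & forall x, `|x - s'.1| <= s'.2 ->
         0 < `|x - pv.1%:~R / pv.2%:R| < pv.2%:R ^- n.+1].
(* A junk value where [Pn] fails makes the relation total, so that choice yields a function to
   iterate. *)
have /choice[F HF] : forall ns : nat * (R * R), exists s'pv : (R * R) * (int * nat),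
    Pn ns.1 ns.2 -> Pn ns.1.+1 s'pv.1 /\ Rn ns.1 ns.2 s'pv.1 s'pv.2.
  move=> [n [xi r]] /=.
  have [[st r0]|nP] := pselect (Pn n (xi, r)); last by exists ((0, 0), (0, 0%N)).
  rewrite /= in st r0.
  have sl : slack n.+1 < slack n.
    by rewrite ltrD2l ltf_pV2 ?posrE ?ltr0n// ltr_nat.
  have sl0 : 0 < slack n.+1 by rewrite addr_gt0// invr_gt0 ltr0n.
  have sl2 : slack n.+1 <= 2.
    by rewrite /slack (_ : 2 = 1 + 1)// lerD2l invf_le1 ?ler1n ?ltr0n.
  have r20 : 0 < r / 2 by rewrite divr_gt0.
  have [xi' [p [v [st' d v2]]]] :=
    stage_step n.+2 oU iU gf nrat (ltn0Sn n) r20 sl0 sl sl2 st.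
  set t := `|xi' - _|; set q := v%:R ^- n.+1 => /andP[t0 tq].
  (* The first two bounds nest the intervals and shrink them to a point; the last two preserve the
     strict inequalities [0 < |x - p / v| < q] on the whole new interval. *)
  pose r' := Num.min (Num.min (r / 2) (n.+1%:R^-1)) (Num.min (t / 2) ((q - t) / 2)).
  have r'0 : 0 < r' by rewrite !lt_min r20 invr_gt0 ltr0n !divr_gt0// subr_gt0.
  have [ra rb] : r' <= r / 2 /\ r' <= n.+1%:R^-1.
    by rewrite /r'; split; rewrite !ge_min lexx ?orbT.
  have [rc rd] : r' <= t / 2 /\ r' <= (q - t) / 2.
    by rewrite /r'; split; rewrite !ge_min lexx ?orbT.
  exists ((xi', r'), (p, v)) => _; split; first by split.
  split => //=; first by move: ra d; clear; lra.
  move=> x xr; rewrite -/q.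
  have h1 := ler_normD (x - xi') (xi' - p%:~R / v%:R).
  have h2 := ler_normD (xi' - x) (x - p%:~R / v%:R).
  move: h1 h2; rewrite !subrKA (distrC xi' x) -/t.
  move: xr rc rd t0 tq; clear => *; apply/andP; split; lra.
pose s := fix s n := if n is m.+1 then (F (m, s m)).1 else (xi0, e).
have sP n : Pn n (s n).
  by elim: n => [|n IH] //=; have [] := HF (n, s n) IH.
have sR n : Rn n (s n) (s n.+1) (F (n, s n)).2 by have [] := HF (n, s n) (sP n).
exists S0, (fun n => (s n).1), (fun n => (s n).2), (fun n => (F (n, s n)).2.1),
  (fun n => (F (n, s n)).2.2); split.
- by move=> n; have [] := sP n.
- by move=> n; have [] := sP n.
- by move=> n; have [] := sR n.
- exact: He.
- by move=> n; have [] := sR n.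
Qed.

(** Finitely many fractions would have a positive least distance to [x], whereas
    [v n ^- n.+1 <= 2 ^- n.+1] tends to 0. *)
Lemma liouville_of_approx (x : R) (p : nat -> int) (v : nat -> nat) :
  (forall n, (2 <= v n)%N /\ 0 < `|x - (p n)%:~R / (v n)%:R| < (v n)%:R ^- n.+1) ->
  liouville R x.
Proof.
move=> H N N1 /finite_seqP[s sE].
have inA n : (N <= n.+1)%N -> (p n, (v n)%:Z) \in s.
  move=> Nn; suff : [set` s] (p n, (v n)%:Z) by [].
  rewrite -sE /=; have [v2 /andP[h1 h2]] := H n; split; first by rewrite lez_nat.
  rewrite -pmulrn h1 /=; apply: lt_le_trans h2 _.
  have v1 : 1 <= (v n)%:R :> R by rewrite ler1n ltnW.
  have v0 : 0 < (v n)%:R :> R by apply: lt_le_trans v1.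
  by rewrite lef_pV2 ?posrE ?exprn_gt0//; apply: ler_weXn2l.
have sp pq : pq \in s -> 0 < `|x - pq.1%:~R / pq.2%:~R|.
  by move=> h; have : [set` s] pq by []; rewrite -sE => -[_ /andP[]].
have [m m0 Hm] : exists2 m : R, 0 < m & forall pq, pq \in s -> m <= `|x - pq.1%:~R / pq.2%:~R|.
  clear -sp; elim: s sp => [|a s IH] sp; first by exists 1.
  have [|m m0 Hm] := IH; first by move=> pq h; apply: sp; rewrite inE h orbT.
  exists (Num.min m `|x - a.1%:~R / a.2%:~R|).
    by rewrite lt_min m0 sp// mem_head.
  move=> pq; rewrite inE => /orP[/eqP ->|h]; first by rewrite ge_min lexx orbT.
  by rewrite ge_min Hm.
pose n := maxn N (Num.truncn (m^-1)).+1.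
have := Hm _ (inA n (leq_trans (leq_maxl _ _) (leqnSn _))).
have [v2 /andP[_ h2]] := H n; rewrite leNgt => /negP; apply.
rewrite -pmulrn; apply: lt_le_trans h2 _.
have n0' : (0 < n)%N by rewrite /n leq_max orbT.
have n0 : 0 < n%:R :> R by rewrite ltr0n.
apply: (@le_trans _ _ n%:R^-1).
  rewrite lef_pV2 ?posrE ?exprn_gt0 ?ltr0n ?(ltnW v2)//.
  apply: (@le_trans _ _ (2 ^+ n.+1)).
    by rewrite -natrX ler_nat; apply: ltnW; apply: ltn_trans (ltnSn _) (ltn_expl _ _).
  by apply: lerXn2r; rewrite ?nnegrE// ler_nat.
rewrite -[leRHS]invrK lef_pV2 ?posrE ?invr_gt0//.
apply: (@le_trans _ _ (Num.truncn (m^-1)).+1%:R); first by rewrite ltW// truncnS_gt.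
by rewrite ler_nat leq_maxr.
Qed.

(** For [N = 20] only denominators below [S0] can occur, and then the numerators are bounded as
    well. *)
Lemma not_liouville (y : R) (S0 : nat) :
  (forall (r : int) (s : nat), (0 < s)%N -> (S0 <= s)%N ->
     1 / s%:R ^+ 20 <= `|y - r%:~R / s%:R|) -> ~ liouville R y.
Proof.
move=> H /(_ 20%N isT); apply.
pose B := (Num.truncn ((`|y| + 1) * S0%:R)).+1.
pose g (ij : 'I_(B + B).+1 * 'I_S0) : int * int := (ij.1%:Z - B%:Z, ij.2%:Z).
apply: (@sub_finite_set _ _ (g @` setT)); last first.
  by apply: finite_image; exact: finite_finset.
move=> [p q] /= [q2 /andP[h1 h2]].
case: q q2 h1 h2 => [q|//] q2 h1 h2.
have q0 : (0 < q)%N by move: q2; rewrite lez_nat; exact: ltnW.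
rewrite -pmulrn in h2.
have qS : (q < S0)%N.
  rewrite ltnNge; apply/negP => /(H p q q0); rewrite mul1r leNgt => /negP; exact.
have q1 : 1 <= q%:R :> R by rewrite ler1n.
have qp : 0 < q%:R :> R by rewrite ltr0n.
have pB : `|p|%N%:R <= (`|y| + 1) * S0%:R :> R.
  have h3 : `|y - p%:~R / q%:R| <= 1.
    apply: ltW; apply: lt_le_trans h2 _; rewrite invf_le1 ?exprn_gt0//.
    exact: exprn_ege1.
  have h4 := ler_normD (p%:~R / q%:R - y) y.
  rewrite subrK distrC normrM normfV (gtr0_norm qp) in h4.
  have : `|p%:~R| / q%:R <= `|y| + 1 by move: h3 h4; clear; lra.
  rewrite ler_pdivrMr// -intr_norm => h5.
  rewrite natr_absz; apply: le_trans h5 _; apply: ler_wpM2l; first by rewrite addr_ge0.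
  by rewrite ler_nat ltnW.
have {}pB : (`|p| < B)%N.
  rewrite -(ltr_nat R); apply: le_lt_trans pB _; exact: truncnS_gt.
have pl : (absz (p + B%:Z)%R < (B + B).+1)%N by move: pB; clear; lia.
exists (Ordinal pl, Ordinal qS) => //; rewrite /g /=; congr (_, _).
by move: pB; clear; lia.
Qed.

End Limit.

Theorem corollary1p3 (R : realType) (U : set R) (f : R -> R)
    (U_open : open U) (U_interval : is_interval U)
    (f_analytic : real_analytic_on U f)
    (f_liouville : f @` (liouville R `&` U) `<=` liouville R) :
  exists p q : {poly R},
    [/\ q != 0, coprimep p q,
        (forall x, U x -> q.[x] != 0) &
        (forall x, U x -> f x = p.[x] / q.[x])].
Proof.
have gf x : U x -> germ f x.
  move=> Ux; have [a [r [r0 H]]] := f_analytic x Ux.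
  exact: germ_of_pseries H.
apply: contrapT => nrat.
(* The construction starts from a point of [U]; on the empty set the fraction 0/1 will do. *)
have [U0|/set0P[x0 Ux0]] := eqVneq U set0.
  apply: nrat; exists 0, 1; split; rewrite ?oner_neq0 ?coprimep1//; by rewrite U0.
have [S0 [u [rad [p [v [st r0 nest inU H]]]]]] :=
  stage_sequence U_open U_interval gf nrat Ux0.
have [x Hx] := nested_intervals r0 nest.
have Ux : U x by apply: inU; exact: Hx.
have Lx : liouville R x.
  apply: (@liouville_of_approx _ x p v) => n; have [_ v2 h] := H n.
  by split => //; apply: h; exact: Hx.
have Lfx : liouville R (f x) by apply: f_liouville; exists x.
apply: (@not_liouville _ (f x) S0) Lfx => r s s0 Ss.
rewrite leNgt; apply/negP => lt1.
(* A violation at [x] has room [d], so by continuity it persists at [u n.+1] for large [n], against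
   [slack n.+1 >= 1]. *)
pose d := 1 / s%:R ^+ 20 - `|f x - r%:~R / s%:R|.
have d0 : 0 < d by rewrite subr_gt0.
have /cvgrPdist_lt/(_ d d0)/nbhs_ballP[e /= e0 He] := germ_continuous (gf x Ux).
pose n := (Num.truncn (e^-1)).+1.
have [rn _ _] := H n.
have n0 : 0 < n.+1%:R :> R by rewrite ltr0n.
have ne : n.+1%:R^-1 < e.
  rewrite -[ltRHS]invrK ltf_pV2 ?posrE ?invr_gt0//.
  apply: lt_trans (truncnS_gt _) _; first by rewrite ltr_nat.
have ball_n : ball x e (u n.+1).
  by rewrite /ball /=; apply: le_lt_trans (Hx n.+1) _; apply: le_lt_trans rn _.
have fd : `|f x - f (u n.+1)| < d by exact: He.
have [_ _ _ /(_ r s s0 Ss) h] := st n.+1.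
have sl : 1 / s%:R ^+ 20 <= slack R n.+1 / s%:R ^+ 20.
  by rewrite ler_pM2r ?invr_gt0 ?exprn_gt0 ?ltr0n// lerDl invr_ge0.
have tri := ler_normD (f (u n.+1) - f x) (f x - r%:~R / s%:R).
rewrite subrKA (distrC (f (u n.+1)) (f x)) in tri.
by move: fd h sl tri; rewrite /d; clear; lra.
Qed.
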